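(* Let $J,R\in\mathbb{R}^{d\times d}$ be constant with $J=-J^\top$ and $R=R^\top\succeq 0$, let $\mathcal{X}\subset\mathbb{R}^d$ be open, let $\mathcal{H}:\mathcal{X}\to\mathbb{R}$ be sufficiently smooth, and consider the dissipative Hamiltonian system $\dot x=[J-R]\nabla\mathcal{H}(x)$, $x(0)=x_0$. Let $m\ge 1$, $\alpha_1,\dots,\alpha_m\ge 0$, let $C_j,D_j:\mathcal{X}\times\mathcal{X}\to\mathbb{R}^{d\times d}$ be continuous $(j=1,\dots,m)$, and set $$\Psi_j(x,y,h)=I+hC_j(x,y)+h^2D_j(x,y),\qquad \overline R(x,y,h)=\sum_{j=1}^m\alpha_j\,\Psi_j(x,y,h)^\top R\,\Psi_j(x,y,h),$$ $$\overline J(x,y,h)=J-\frac{h^2}{12}\Big(T_0\big(\tfrac{x+y}{2}\big)+T_2\big(\tfrac{x+y}{2}\big)\Big),\qquad \overline A=\overline J-\overline R,$$ with $T_0,\dots,T_3$ as defined in the context. Suppose that for all admissible pairs $(x,y)$ $$\sum_{j=1}^m\alpha_j=1,\qquad \sum_{j=1}^m\alpha_j\big(C_j^\top R+RC_j\big)(x,y)=0,$$ $$\sum_{j=1}^m\alpha_j\big(C_j^\top RC_j+D_j^\top R+RD_j\big)(x,y)=-\frac{1}{12}\Big(T_1\big(\tfrac{x+y}{2}\big)+T_3\big(\tfrac{x+y}{2}\big)\Big),$$ $$\sum_{j=1}^m\alpha_j\big(C_j^\top RD_j+D_j^\top RC_j\big)(x,y)=0.$$ Then the modified AVF discrete gradient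 method $$\frac{x_{n+1}-x_n}{h}=\overline A(x_n,x_{n+1},h)\,\overline\nabla_{\mathrm{AVF}}\mathcal{H}(x_n,x_{n+1})$$ is energy-consistent and of fourth order.
   Context: Admissible pairs are those $(x,y)\in\mathcal{X}\times\mathcal{X}$ for which the segment between $x$ and $y$ lies in $\mathcal{X}$; all functions of $(x,y)$ and all numerical steps are considered for such pairs only. The average vector field (AVF) discrete gradient is $\overline\nabla_{\mathrm{AVF}}\mathcal{H}(x,y)=\int_0^1\nabla\mathcal{H}((1-\xi)x+\xi y)\,\mathrm{d}\xi$. With $S(x)=\nabla^2\mathcal{H}(x)$ (the Hessian), define $$T_0=JSJSJ,\quad T_1=RSJSJ+JSRSJ+JSJSR,\quad T_2=RSRSJ+RSJSR+JSRSR,\quad T_3=RSRSR,$$ all evaluated at $x$. ''Sufficiently smooth'' means of class $C^k$ for a sufficiently large fixed integer $k$. Energy-consistent: $\overline A=\overline J-\overline R$ with $\overline J(x,y,h)$ pointwise skew-symmetric and $\overline R(x,y,h)$ pointwise symmetric positive semi-definite, $\lim_{y\to x,\,h\to 0}\overline A(x,y,h)=J-R$, and consequently every numerical step satisfies $\mathcal{H}(x_{n+1})-\mathcal{H}(x_n)\le 0$ for every step size $h>0$, with equality if $R=0$. Of fourth order: the local (one-step) error is $O(h^5)$, that is, if $x(t)$ is the exact solution with $x(0)=x_0$ and $x_1=x_1(h)$ solves the scheme started at $x_0$ with step size $h$ and $x_1(h)\to x_0$ as $h\to0$, then $\|x(h)-x_1(h)\|=O(h^5)$ as $h\to 0$.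 *)

(* Defs.v *)
From HB Require Import structures.
From mathcomp Require Import all_boot all_order all_algebra.
From mathcomp Require Import all_classical all_reals all_analysis.

Set Implicit Arguments.
Unset Strict Implicit.
Unset Printing Implicit Defensive.

Import Order.TTheory GRing.Theory Num.Theory.
Import numFieldNormedType.Exports.

Local Open Scope classical_set_scope.
Local Open Scope ring_scope.

(* Functions on a subset X of K^d are total functions of which only the values
   on X are used: X is open, so the partial derivatives at the points of X only
   depend on these values. *)

Section Calculus.
Context {K : realType} {d : nat}.
Implicit Types (X : set 'cV[K]_d) (f : 'cV[K]_d -> K) (x y : 'cV[K]_d).

Definition partial (i : 'I_d) f x : K := 'D_(delta_mx i 0) f x.

Definition grad f x : 'cV[K]_d := \col_i partial i f x.

Definition hess f x : 'M[K]_d := \matrix_(i, j) partial j (partial i f) x.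

Fixpoint classC (k : nat) X f : Prop :=
  (forall x, X x -> {for x, continuous f}) /\
  if k is k'.+1 then
    forall i : 'I_d,
      (forall x, X x -> derivable f x (delta_mx i 0)) /\
      classC k' X (partial i f)
  else True.

(* In particular x and y themselves are in X. *)
Definition admissible X x y : Prop :=
  forall xi : K, 0 <= xi <= 1 -> X ((1 - xi) *: x + xi *: y).

Definition midpoint x y : 'cV[K]_d := 2^-1 *: (x + y).

Definition avf f x y : 'cV[K]_d :=
  \col_i \int[lebesgue_measure]_(xi in `[0, 1])
    grad f ((1 - xi) *: x + xi *: y) i 0.

End Calculus.

Section MatrixPredicates.
Context {K : realType} {d : nat}.
Implicit Types A : 'M[K]_d.

Definition skew_symmetric A : Prop := A^T = - A.

Definition sym_psd A : Prop :=
  A^T = A /\ forall v : 'cV[K]_d, 0 <= (v^T *m A *m v) 0 0.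

End MatrixPredicates.

Section DiscreteGradientMethod.
Context {K : realType} {d : nat}.
Variables (X : set 'cV[K]_d) (H : 'cV[K]_d -> K) (J R : 'M[K]_d).
Implicit Types (x y : 'cV[K]_d) (h : K).
Implicit Types A Jbar Rbar : 'cV[K]_d -> 'cV[K]_d -> K -> 'M[K]_d.

Definition avf_step A x y h : Prop :=
  [/\ admissible X x y, 0 < h &
      h^-1 *: (y - x) = A x y h *m avf H x y].

Definition energy_consistent Jbar Rbar : Prop :=
  let A := fun x y h => Jbar x y h - Rbar x y h in
  [/\ forall x y h, admissible X x y -> skew_symmetric (Jbar x y h),
      forall x y h, admissible X x y -> sym_psd (Rbar x y h),
      forall x, X x -> A x yh.1 yh.2 @[yh --> (x, 0 : K)] --> J - R,
      forall x y h, avf_step A x y h -> H y - H x <= 0 &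
      R = 0 -> forall x y h, avf_step A x y h -> H y - H x = 0].

(* Solution on [0, T) of x' = (J - R) grad H(x), x(0) = x0.  The equation at
   t = 0, with the right derivative, follows from continuity. *)
Definition exact_solution (x0 : 'cV[K]_d) (T : K) (x : K -> 'cV[K]_d) : Prop :=
  [/\ x 0 = x0,
      forall t : K, 0 <= t < T -> X (x t),
      {within `[0, T[, continuous x} &
      forall t : K, 0 < t < T -> is_derive t 1 x ((J - R) *m grad H (x t))].

(* Local error O(h^(p+1)) as h -> 0 through the step sizes h > 0.  The norm of
   the library on K^d is the maximum norm, equivalent to the Euclidean one. *)
Definition of_order (p : nat) A : Prop :=
  forall (x0 : 'cV[K]_d) (T : K) (x x1 : K -> 'cV[K]_d),
    0 < T -> exact_solution x0 T x ->
    (\forall h \near 0^'+, avf_step A x0 (x1 h) h) ->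
    x1 h @[h --> 0^'+] --> x0 ->
    (fun h => x h - x1 h) =O_ (0^'+) (fun h => h ^+ p.+1).

End DiscreteGradientMethod.

Section ModifiedMethod.
Context {K : realType} {d : nat}.
Variables (H : 'cV[K]_d -> K) (J R : 'M[K]_d).
Implicit Types (x y : 'cV[K]_d) (h : K).

Definition T0 x : 'M[K]_d :=
  let S := hess H x in J *m S *m J *m S *m J.

Definition T1 x : 'M[K]_d :=
  let S := hess H x in
  R *m S *m J *m S *m J + J *m S *m R *m S *m J + J *m S *m J *m S *m R.

Definition T2 x : 'M[K]_d :=
  let S := hess H x in
  R *m S *m R *m S *m J + R *m S *m J *m S *m R + J *m S *m R *m S *m R.

Definition T3 x : 'M[K]_d :=
  let S := hess H x in R *m S *m R *m S *m R.

Definition Jbar x y h : 'M[K]_d :=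
  J - (h ^+ 2 / 12) *: (T0 (midpoint x y) + T2 (midpoint x y)).

Definition Psi (C D : 'cV[K]_d -> 'cV[K]_d -> 'M[K]_d) x y h : 'M[K]_d :=
  1%:M + h *: C x y + h ^+ 2 *: D x y.

Definition Rbar (m : nat) (alpha : 'I_m -> K)
    (C D : 'I_m -> 'cV[K]_d -> 'cV[K]_d -> 'M[K]_d) x y h : 'M[K]_d :=
  \sum_(j < m) alpha j *:
    ((Psi (C j) (D j) x y h)^T *m R *m Psi (C j) (D j) x y h).

End ModifiedMethod.

(* Main.v *)
Require Import Defs.
From HB Require Import structures.
From mathcomp Require Import all_boot all_order all_algebra.
From mathcomp Require Import all_classical all_reals all_analysis.
From mathcomp Require Import ring lra.

Set Implicit Arguments.
Unset Strict Implicit.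
Unset Printing Implicit Defensive.

Import Order.TTheory GRing.Theory Num.Theory.
Import numFieldNormedType.Exports.

Local Open Scope classical_set_scope.
Local Open Scope ring_scope.

(** Write [B = J - R], [v] for the averaged gradient and [S] for the Hessian.

    Energy.  The averaged gradient is a discrete gradient: the inner product of
    [v] with [y - x] is [H y - H x], because the derivative of [H] along the
    chord is the inner product of the gradient with [y - x].  For a step this
    increment is [h] times the quadratic form of [Jbar - Rbar] at [v], where the
    skew-symmetric part contributes nothing and [Rbar], a nonnegative
    combination of congruent copies of [R], contributes a nonpositive amount
    ([energy_balance]).  That [Jbar] is skew-symmetric rests on the symmetry of
    the Hessian ([partialC]).

    Shape of the method.  The expansion of [Rbar] in powers of [h] has the
    matrices of the three conditions on [C] and [D] as coefficients, and the
    signs of the words [T0], ..., [T3] are those of a product of differences, so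
    that the matrix of the method is
    [B - h^2/12 B S B S B] at the midpoint, up to [O(h^4)]
    ([modified_expansion]).

    Order.  Let [c] be the exact solution.  Expand [c] around the middle of the
    step.  The gap between the chord and [c] vanishes at both ends; its leading
    term is [h^2/2 (s - s^2) c''] and the next one is odd around the middle
    ([chord_gap]).  Hence the gradient along the chord is the gradient along
    the solution, plus [h^2/2 (s - s^2) S c''], plus an odd term of order [h^3],
    up to [O(h^4)] ([grad_gap]).  The average over the step is exact for the
    first term, gives the factor 1/12 for the second one, and cancels the odd
    term ([avf_defect]); as [c'' = B S B grad H], the correction of the method
    compensates precisely the second term, and the exact solution satisfies the
    scheme with a defect of order [h^4] ([increment_consistency]).  The scheme
    depends on its end point in a Lipschitz way ([increment_lipschitz]), so that
    the local error [e] satisfies [|e| <= h (C1 |e| + C2 h^4)], which gives the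
    fifth power of [h] ([implicit_step_error]).

    Integrals are only met through antiderivatives: two functions whose
    derivatives are close have close increments, by the mean value theorem
    ([avf_approx]). *)

(** * The maximum norm of matrices *)

Section MatrixNorm.
Context {K : realType}.

Lemma ler_norm_coord m n (A : 'M[K]_(m, n)) i j : `|A i j| <= `|A|.
Proof. by rewrite [leRHS]/Num.Def.normr /= mx_normrE; exact: (le_bigmax _ _ (i, j)). Qed.

Lemma mx_norm_le m n (A : 'M[K]_(m, n)) (C : K) :
  0 <= C -> (forall i j, `|A i j| <= C) -> `|A| <= C.
Proof.
by move=> C0 uC; rewrite [leLHS]/Num.Def.normr /= mx_normrE bigmax_le// => -[i j] _.
Qed.

Lemma ler_norm_mulmx m n p (A : 'M[K]_(m, n)) (B : 'M[K]_(n, p)) :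
  `|A *m B| <= n%:R * (`|A| * `|B|).
Proof.
apply: mx_norm_le => [|i j]; first by rewrite !mulr_ge0.
rewrite mxE (le_trans (ler_norm_sum _ _ _))//.
rewrite -[n in n%:R]card_ord -sumr_const mulr_suml ler_sum// => k _.
by rewrite mul1r normrM ler_pM// ler_norm_coord.
Qed.

End MatrixNorm.

(** * Domination along a filter *)

Section Domination.
Context {K : realType} {T : Type} (F : set_system T) {FF : Filter F}.

(** A Landau symbol with an arbitrary filter and without a sign condition on the
    bound: the same rules then serve limits in one variable, estimates that are
    uniform over a step, and estimates in terms of the unknown local error. *)
Definition dominated {V : normedModType K} (g : T -> K) (u : T -> V) : Prop :=
  exists C : K, \forall t \near F, `|u t| <= C * g t.

Section Module.
Context {V : normedModType K}.
Implicit Types (f g : T -> K) (u v : T -> V).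

Lemma dominated_near g u v :
  (\forall t \near F, u t = v t) -> dominated g u -> dominated g v.
Proof.
move=> uv [C ugC]; exists C.
by apply: filterS2 uv ugC => t ->.
Qed.

Lemma dominated_le f g u : (\forall t \near F, 0 <= f t <= g t) ->
  dominated f u -> dominated g u.
Proof.
move=> fg [C ufC]; exists `|C|; apply: filterS2 fg ufC => t /andP[f0 fg].
move=> /le_trans; apply; rewrite (@le_trans _ _ (`|C| * f t))//.
  by rewrite ler_wpM2r// ler_norm.
by rewrite ler_wpM2l.
Qed.

Lemma dominated_bound_eq f g u :
  (\forall t \near F, f t = g t) -> dominated f u -> dominated g u.
Proof.
by move=> fg [C uC]; exists C; apply: filterS2 fg uC => t ->.
Qed.

Lemma dominatedD g u v :
  dominated g u -> dominated g v -> dominated g (fun t => u t + v t).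
Proof.
move=> [C uC] [D vD]; exists (C + D); apply: filterS2 uC vD => t uC vD.
by rewrite (le_trans (ler_normD _ _))// mulrDl lerD.
Qed.

Lemma dominatedN g u : dominated g u -> dominated g (fun t => - u t).
Proof. by move=> [C uC]; exists C; apply: filterS uC => t; rewrite normrN. Qed.

Lemma dominatedB g u v :
  dominated g u -> dominated g v -> dominated g (fun t => u t - v t).
Proof. by move=> ug /dominatedN; exact: dominatedD. Qed.

Lemma dominated_sum (I : Type) (r : seq I) g (u : I -> T -> V) :
  (forall i, dominated g (u i)) -> dominated g (fun t => \sum_(i <- r) u i t).
Proof.
move=> ug; elim: r => [|i r IH].
  by exists 0; apply: nearW => t; rewrite big_nil normr0 mul0r.
apply: dominated_near (dominatedD (ug i) IH).
by apply: nearW => t; rewrite big_cons.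
Qed.

Lemma dominatedZ f g (k : T -> K) u : dominated f k -> dominated g u ->
  dominated (fun t => f t * g t) (fun t => k t *: u t).
Proof.
move=> [C kC] [D uD]; exists (C * D); apply: filterS2 kC uD => t kC uD.
by rewrite normrZ mulrACA ler_pM.
Qed.

Lemma cvg_is_dominated u (a : V) : u @ F --> a -> dominated (fun=> 1) u.
Proof.
move=> ua; exists (`|a| + 1).
have /cvgrPdist_le/(_ _ ltr01) := ua.
apply: filterS => t; rewrite distrC mulr1 => le1.
by rewrite -[u t](subrK a) (le_trans (ler_normD _ _))// addrC lerD2l.
Qed.

Lemma dominated_is_cvg g u (a : V) : dominated g (fun t => u t - a) ->
  g @ F --> 0 -> u @ F --> a.
Proof.
move=> [C uC] g0; apply/cvgrPdist_le => e e0.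
have C0 : 0 < `|C| + 1 by rewrite ltr_wpDl.
have /cvgrPdist_le/(_ (e / (`|C| + 1))) := g0.
rewrite divr_gt0// => /(_ isT); apply: filterS2 uC => t uC.
rewrite sub0r normrN ler_pdivlMr// distrC => ge.
apply: le_trans uC _; apply: le_trans (ler_norm _) _; rewrite normrM.
apply: le_trans ge; rewrite mulrC ler_wpM2l//.
by rewrite lerDl.
Qed.

Lemma cvg_scale_dominated (k : T -> K) u : k @ F --> 0 ->
  dominated (fun=> 1) u -> k t *: u t @[t --> F] --> (0 : V).
Proof.
move=> k0 [C uC]; apply: (dominated_is_cvg (g := fun t => `|k t|)).
  exists C; apply: filterS uC => t; rewrite mulr1 subr0 normrZ mulrC => uC.
  by rewrite ler_wpM2r.
by rewrite -(normr0 K); exact: cvg_norm k0.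
Qed.

End Module.

Lemma dominatedM f g (k u : T -> K) : dominated f k -> dominated g u ->
  dominated (fun t => f t * g t) (fun t => k t * u t).
Proof. exact: (@dominatedZ K). Qed.

Lemma dominated_refl (g : T -> K) :
  (\forall t \near F, 0 <= g t) -> dominated g g.
Proof.
by exists 1; near=> t; rewrite mul1r ger0_norm//; near: t.
Unshelve. all: by end_near. Qed.

Lemma dominated_mulmx m n p f g (A : T -> 'M[K]_(m, n)) (B : T -> 'M[K]_(n, p)) :
  dominated f A -> dominated g B ->
  dominated (fun t => f t * g t) (fun t => A t *m B t).
Proof.
move=> [C uC] [D BD]; exists (n%:R * (C * D)); apply: filterS2 uC BD => t uC BD.
by rewrite (le_trans (ler_norm_mulmx _ _))// -mulrA ler_wpM2l// mulrACA ler_pM.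
Qed.

Lemma dominated_cst {V : normedModType K} (a : V) :
  dominated (fun=> 1) (fun=> a).
Proof. by exists `|a|; apply: nearW => t; rewrite mulr1. Qed.

Lemma dominated_coord m n g (A : T -> 'M[K]_(m, n)) i j :
  dominated g A -> dominated g (fun t => A t i j).
Proof.
move=> [C uC]; exists C; apply: filterS uC => t.
exact/le_trans/ler_norm_coord.
Qed.

Lemma bounded_scale {V : normedModType K} g (k : T -> K) (u : T -> V) :
  dominated (fun=> 1) k -> dominated g u -> dominated g (fun t => k t *: u t).
Proof.
move=> k1 /(dominatedZ k1); apply: dominated_bound_eq.
by apply: nearW => t; rewrite mul1r.
Qed.

Lemma bounded_mulmx m n p g (A : T -> 'M[K]_(m, n)) (B : T -> 'M[K]_(n, p)) :
  dominated (fun=> 1) A -> dominated g B -> dominated g (fun t => A t *m B t).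
Proof.
move=> A1 /(dominated_mulmx A1); apply: dominated_bound_eq.
by apply: nearW => t; rewrite mul1r.
Qed.

Lemma mulmx_bounded m n p g (A : T -> 'M[K]_(m, n)) (B : T -> 'M[K]_(n, p)) :
  dominated g A -> dominated (fun=> 1) B -> dominated g (fun t => A t *m B t).
Proof.
move=> Ag /(dominated_mulmx Ag); apply: dominated_bound_eq.
by apply: nearW => t; rewrite mulr1.
Qed.

(** The entries may be bounded with different constants; the number of entries
    is finite, so that the sum of these constants serves all of them. *)
Lemma dominated_mx m n g (A : T -> 'M[K]_(m, n)) :
  (\forall t \near F, 0 <= g t) ->
  (forall i j, dominated g (fun t => A t i j)) -> dominated g A.
Proof.
move=> g0 Ag; have sumA : dominated g
    (fun t => \sum_i \sum_j `|A t i j|).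
  apply: dominated_sum => i; apply: dominated_sum => j.
  by have [C uC] := Ag i j; exists C; apply: filterS uC => t; rewrite normr_id.
have [C uC] := sumA; exists C; apply: filterS2 g0 uC => t g0; apply: le_trans.
rewrite ger0_norm ?sumr_ge0//; last by move=> i _; rewrite sumr_ge0.
apply: mx_norm_le => [|i j].
  by rewrite sumr_ge0// => i _; rewrite sumr_ge0.
rewrite (bigD1 i)//= (bigD1 j)//= -addrA lerDl addr_ge0//.
  by rewrite sumr_ge0.
by rewrite sumr_ge0// => i' _; rewrite sumr_ge0.
Qed.

End Domination.
Arguments dominated_cst {K T} F {FF V} a.
(** * Mean value estimates *)

Section MeanValue.
Context {K : realType}.

Lemma is_derive_line (V W : normedModType K) (f : V -> W) (p v : V) (s : K) :
  derivable f (p + s *: v) v ->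
  is_derive s 1 (fun s => f (p + s *: v)) ('D_v f (p + s *: v)).
Proof.
have E : (fun h : K => h^-1 *: (f (p + (h *: (1 : K) + s) *: v) - f (p + s *: v)))
    = (fun h => h^-1 *: (f (h *: v + (p + s *: v)) - f (p + s *: v))).
  apply/funext => h; congr (_ *: (f _ - _)).
  by rewrite scaler1 scalerDl addrCA.
move=> df; split; first by rewrite /derivable E.
by rewrite /derive E.
Qed.

(** Increments of a coordinate may be negative, whence endpoints in either
    order. *)
Lemma mean_value_between (f df : K -> K) (a b : K) :
  (forall t, Num.min a b < t < Num.max a b -> is_derive t 1 f (df t)) ->
  {within `[Num.min a b, Num.max a b], continuous f} ->
  exists2 c, Num.min a b <= c <= Num.max a b & f b - f a = df c * (b - a).
Proof.
have main (u v : K) : u <= v -> (forall t, u < t < v -> is_derive t 1 f (df t)) ->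
    {within `[u, v], continuous f} ->
    exists2 c, u <= c <= v & f v - f u = df c * (v - u).
  move=> uv fd fc; have fd' t : t \in `]u, v[ -> is_derive t 1 f (df t).
    by rewrite in_itv; exact: fd.
  by have [c] := MVT_segment uv fd' fc; rewrite in_itv /= => cuv E; exists c.
have [ab|/ltW ba] := leP a b => fd fc; first exact: main.
have [c cab E] := main _ _ ba fd fc.
by exists c => //; rewrite -opprB E -mulrN opprB.
Qed.

Lemma derive_le_increment (f df : K -> K) (a b e : K) :
  (forall t, Num.min a b < t < Num.max a b -> is_derive t 1 f (df t)) ->
  {within `[Num.min a b, Num.max a b], continuous f} ->
  (forall t, Num.min a b <= t <= Num.max a b -> `|df t| <= e) ->
  `|f b - f a| <= e * `|b - a|.
Proof.
move=> fd fc dfe; have [c cab ->] := mean_value_between fd fc.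
by rewrite normrM ler_wpM2r// dfe.
Qed.

End MeanValue.

Section PartialDerivatives.
Context {K : realType} {d : nat}.
Implicit Types (X : set 'cV[K]_d) (f : 'cV[K]_d -> K) (x y : 'cV[K]_d).

Lemma is_derive_coordinate_line f x (i : 'I_d) (s : K) :
  derivable f (x + s *: delta_mx i 0) (delta_mx i 0) ->
  is_derive s 1 (fun s => f (x + s *: delta_mx i 0))
    (partial i f (x + s *: delta_mx i 0)).
Proof. exact: is_derive_line. Qed.

Lemma continuous_is_derive (g : K -> K) (dg : K -> K) (A : set K) :
  (forall s, A s -> is_derive s 1 g (dg s)) -> {within A, continuous g}.
Proof.
move=> gd; apply: continuous_in_subspaceT => s; rewrite inE => As.
apply/differentiable_continuous/derivable1_diffP.
by have [] := gd _ As.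
Qed.

(** Moving from [x] to [y] one coordinate at a time stays in the closed ball of
    the maximum norm around [x] through [y]; each move obeys the mean value
    theorem in one variable.  With [a = 0] this is a Lipschitz estimate, with
    [a] the gradient at [x] a first-order Taylor estimate. *)
Lemma increment_partial_le f x y (a : 'I_d -> K) (e : K) :
  (forall w i, `|w - x| <= `|y - x| -> derivable f w (delta_mx i 0)) ->
  (forall w i, `|w - x| <= `|y - x| -> `|partial i f w - a i| <= e) ->
  `|f y - f x - \sum_i a i * (y i 0 - x i 0)| <= d%:R * (e * `|y - x|).
Proof.
move=> fd fe.
(* The first [k] coordinates have been moved. *)
pose w k : 'cV[K]_d := \col_i if (i < k)%N then y i 0 else x i 0.
have w0 : w 0 = x by apply/colP => i; rewrite mxE.
have wd : w d = y by apply/colP => i; rewrite mxE ltn_ord.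
have -> : f y - f x = \sum_(i < d) (f (w i.+1) - f (w i)).
  by rewrite -(big_mkord xpredT (fun i => f (w i.+1) - f (w i)))
    telescope_sumr// wd w0.
rewrite -sumrB (le_trans (ler_norm_sum _ _ _))//.
rewrite -[d in d%:R]card_ord -sumr_const mulr_suml ler_sum// => i _.
rewrite mul1r.
set t := y i 0 - x i 0.
have wS s : 0 <= s <= 1 -> `|w i + (s * t) *: delta_mx i 0 - x| <= `|y - x|.
  move=> /andP[s0 s1]; apply: mx_norm_le => // j k; rewrite !mxE ord1 eqxx andbT.
  have [->|ji] := eqVneq j i.
    rewrite ltnn mulr1 addrAC subrr add0r normrM ger0_norm//.
    rewrite (@le_trans _ _ `|t|)// ?ler_piMl//.
    by have := ler_norm_coord (y - x) i 0; rewrite !mxE.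
  rewrite mulr0 addr0; case: ifP => _; last by rewrite subrr normr0.
  by have := ler_norm_coord (y - x) j 0; rewrite !mxE.
pose g s := f (w i + s *: delta_mx i 0) - a i * s.
have mS s : Num.min 0 t <= s <= Num.max 0 t ->
    `|w i + s *: delta_mx i 0 - x| <= `|y - x|.
  have [t0|t0 ts] := eqVneq t 0.
    rewrite t0 minxx maxxx -eq_le => /eqP<-.
    by have := wS 0; rewrite mul0r; apply; rewrite lexx ler01.
  rewrite -[s](divfK t0) wS//; move: ts.
  have [t_gt0|t_le0] := ltP 0 t.
    by rewrite ler_pdivlMr// ler_pdivrMr// mul0r mul1r.
  have t_lt0 : t < 0 by rewrite lt_neqAle t0.
  by rewrite ler_ndivlMr// ler_ndivrMr// mul0r mul1r andbC.
have gd s : Num.min 0 t <= s <= Num.max 0 t ->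
    is_derive s 1 g (partial i f (w i + s *: delta_mx i 0) - a i).
  move=> /mS ws; have fds := is_derive_coordinate_line (fd _ i ws).
  apply: is_deriveB.
  have := @is_deriveZ _ _ _ id (a i) s 1 1 (is_derive_id _ _).
  by rewrite scaler1.
have -> : f (w i.+1) - f (w i) - a i * t = g t - g 0.
  rewrite /g scale0r addr0 mulr0 subr0 addrAC; congr (f _ - _ - _).
  apply/colP => j; rewrite !mxE eqxx andbT ltnS leq_eqVlt.
  have [/val_inj ->|ji] := eqVneq (val j) (val i).
    by rewrite ltnn eqxx mulr1 addrC subrK.
  by rewrite -val_eqE (negbTE ji) mulr0 addr0.
have [x0|//] := boolP (0 <= e); last first.
  move=> e0; have := le_trans (normr_ge0 _) (fe x i _).
  by rewrite subrr normr0 (negbTE e0) normr_ge0 => /(_ isT).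
apply: le_trans (derive_le_increment (e := e) _ _ _) _.
- by move=> s /andP[/ltW s0 /ltW s1]; apply: gd; rewrite s0.
- by apply: continuous_is_derive => s /=; rewrite in_itv /=; exact: gd.
- by move=> s /mS/(fe _ i).
rewrite subr0 ler_wpM2l//.
by have := ler_norm_coord (y - x) i 0; rewrite !mxE.
Qed.

End PartialDerivatives.

(** * Smooth functions of several variables *)

Section SmoothFunctions.
Context {K : realType} {d : nat}.
Implicit Types (X : set 'cV[K]_d) (f g : 'cV[K]_d -> K) (x y : 'cV[K]_d).

Lemma classC_continuous n X f x : classC n X f -> X x -> {for x, continuous f}.
Proof. by case: n => [|n] [fc _]; exact: fc. Qed.

Lemma classC_derivable n X f x i :
  classC n.+1 X f -> X x -> derivable f x (delta_mx i 0).
Proof. by move=> [_ fX] Xx; have [fd _] := fX i; exact: fd. Qed.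

Lemma classC_partial n X f i : classC n.+1 X f -> classC n X (partial i f).
Proof. by move=> [_ /(_ i)[]]. Qed.

Lemma classCW n X f : classC n.+1 X f -> classC n X f.
Proof.
elim: n f => [|n IH] f [fc fX]; split=> // i.
by have [fd fi] := fX i; split=> //; exact: IH.
Qed.

Lemma norm_delta_mx_le (i : 'I_d) : `|delta_mx i 0 : 'cV[K]_d| <= 1.
Proof.
apply: mx_norm_le => // j k; rewrite mxE.
by case: (_ && _); rewrite ?normr1 ?normr0.
Qed.

Lemma nbhs_closed_ball (P : set 'cV[K]_d) x : nbhs x P ->
  exists2 r, 0 < r & forall y, `|y - x| <= r -> P y.
Proof.
move=> /nbhs_ballP[r /= r0 rP]; exists (r / 2) => [|y yx]; first exact: divr_gt0.
apply: rP; rewrite -ball_normE /= distrC (le_lt_trans yx)//.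
by rewrite ltr_pdivrMr// ltr_pMr// ltr1n.
Qed.

(** Continuity of the partial derivatives makes [f] differentiable.  It is
    enough to see that the difference between [f] along the curve and the linear
    combination of the coordinates given by the gradient at time [t] has
    derivative zero at [t]; [increment_partial_le] bounds its increments. *)
Lemma is_derive_comp X f (c : K -> 'cV[K]_d) (dc : 'cV[K]_d) (t : K) :
  open X -> classC 1 X f -> X (c t) -> is_derive t 1 c dc ->
  is_derive t 1 (fun s => f (c s)) (\sum_i partial i f (c t) * dc i 0).
Proof.
move=> oX f1 Xct ct.
pose a i := partial i f (c t).
have aderiv i : is_derive t 1 (fun s => a i * c s i 0) (a i * dc i 0).
  have ci : is_derive t 1 (fun s => c s i 0) (dc i 0).
    have [cd <-] := ct; split; first exact: (derivable_mxP _ _ _).1.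
    by rewrite derive_mx// mxE.
  exact: (@is_deriveZ _ _ _ (fun s => c s i 0) (a i)).
have sderiv : is_derive t 1 (fun s => \sum_i a i * c s i 0)
    (\sum_i a i * dc i 0).
  have -> : (fun s => \sum_i a i * c s i 0) = \sum_i (fun s => a i * c s i 0).
    by apply/funext => s; rewrite fct_sumE.
  exact: is_derive_sum.
pose G s := f (c s) - \sum_i a i * c s i 0.
suff Gd : is_derive t 1 G 0.
  have -> : (fun s => f (c s)) = G \+ (fun s => \sum_i a i * c s i 0).
    by apply/funext => s; rewrite /= /G subrK.
  by rewrite -[X in is_derive _ _ _ X]add0r; exact: is_deriveD.
have cderiv : h^-1 *: (c (h *: 1 + t) - c t) @[h --> 0^'] --> dc.
  by have [cd <-] := ct.
have [C0 cC0] := cvg_is_dominated cderiv.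
pose C := `|C0|; have C_ge0 : 0 <= C by exact: normr_ge0.
have cC : \forall h \near 0^', `|c (h *: 1 + t) - c t| <= C * `|h|.
  near=> h; have h0 : h != 0 by near: h; exact: nbhs_dnbhs_neq.
  rewrite -ler_pdivrMr ?normr_gt0// mulrC -normfV -normrZ.
  rewrite (@le_trans _ _ (C0 * 1)) ?mulr1 ?ler_norm//.
  by rewrite -[leRHS]mulr1; near: h.
have Gcvg : h^-1 *: (G (h *: 1 + t) - G t) @[h --> 0^'] --> (0 : K).
  apply/cvgrPdist_le => e e0.
  pose eps := e / (d%:R * C + 1).
  have D0 : 0 < d%:R * C + 1 by rewrite ltr_wpDl ?mulr_ge0.
  have eps0 : 0 < eps by rewrite divr_gt0.
  have : nbhs (c t) [set w | X w /\ forall i, `|partial i f w - a i| <= eps].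
    apply: filterI; first exact: open_nbhs_nbhs.
    have : \forall w \near c t, forall i, `|partial i f w - a i| <= eps.
      refine (@filter_forall _ 'I_d (fun i w => `|partial i f w - a i| <= eps)
        (nbhs (c t)) _ _) => i.
      have := classC_continuous (classC_partial i f1) Xct.
      by move=> /cvgrPdist_le/(_ _ eps0); apply: filterS => w; rewrite distrC.
    exact: filterS.
  move=> /nbhs_closed_ball[r r0 rP].
  near=> h.
  have h0 : h != 0 by near: h; exact: nbhs_dnbhs_neq.
  have ch : `|c (h *: 1 + t) - c t| <= C * `|h| by near: h.
  have chr : `|c (h *: 1 + t) - c t| <= r.
    apply: (le_trans ch); rewrite (@le_trans _ _ ((C + 1) * `|h|))//.
      by rewrite ler_wpM2r// lerDl.
    rewrite mulrC -ler_pdivlMr ?ltr_wpDl//.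
    by near: h; apply: dnbhs0_le; rewrite divr_gt0// ltr_wpDl.
  rewrite sub0r normrN normrZ normfV mulrC ler_pdivrMr ?normr_gt0//.
  have -> : G (h *: 1 + t) - G t = f (c (h *: 1 + t)) - f (c t)
      - \sum_i a i * (c (h *: 1 + t) i 0 - c t i 0).
    under eq_bigr do rewrite mulrBr.
    by rewrite sumrB /G; ring.
  apply: (@le_trans _ _ (d%:R * (eps * `|c (h *: 1 + t) - c t|))).
    apply: increment_partial_le => w i wr; have [Xw aw] := rP _ (le_trans wr chr).
      exact: classC_derivable f1 Xw.
    exact: aw.
  rewrite mulrCA (@le_trans _ _ (eps * (d%:R * (C * `|h|))))//.
    by rewrite !ler_wpM2l// ltW.
  have -> : eps * (d%:R * (C * `|h|)) = eps * (d%:R * C) * `|h| by ring.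
  rewrite ler_wpM2r// /eps mulrAC ler_pdivrMr//.
  by rewrite ler_wpM2l ?ltW// ltrDl.
by split; [exact: cvgP Gcvg|exact: cvg_lim Gcvg].
Unshelve. all: by end_near. Qed.

Definition second_increment f x (u v : 'cV[K]_d) : K :=
  f (x + u + v) - f (x + u) - f (x + v) + f x.

Lemma second_incrementC f x u v :
  second_increment f x u v = second_increment f x v u.
Proof.
rewrite /second_increment; have -> : x + u + v = x + v + u by exact: addrAC.
by congr (_ + _); exact: addrAC.
Qed.

(** The mean value theorem applied along direction [j], then along [i]. *)
Lemma second_increment_partial f x (i j : 'I_d) (h : K) : 0 < h ->
  (forall w, `|w - x| <= 2 * h -> derivable f w (delta_mx j 0)) ->
  (forall w, `|w - x| <= 2 * h -> derivable (partial j f) w (delta_mx i 0)) ->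
  exists2 w, `|w - x| <= 2 * h &
    second_increment f x (h *: delta_mx i 0) (h *: delta_mx j 0)
    = h * (h * partial i (partial j f) w).
Proof.
move=> h0 fj fij.
have h_ge0 : 0 <= h by exact: ltW.
pose ei : 'cV[K]_d := delta_mx i 0; pose ej : 'cV[K]_d := delta_mx j 0.
have near_x (s t : K) : 0 <= s <= h -> 0 <= t <= h ->
    `|x + s *: ei + t *: ej - x| <= 2 * h.
  move=> /andP[s0 sh] /andP[t0 th].
  rewrite addrAC (addrAC x) subrr add0r (le_trans (ler_normD _ _))// !normrZ !ger0_norm//.
  rewrite mulr_natl mulr2n lerD//.
    by rewrite (le_trans _ sh)// ler_piMr// norm_delta_mx_le.
  by rewrite (le_trans _ th)// ler_piMr// norm_delta_mx_le.
have near_x' (s t : K) : 0 <= s <= h -> 0 <= t <= h ->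
    `|x + t *: ej + s *: ei - x| <= 2 * h.
  by rewrite (addrAC x); exact: near_x.
have h1 : 0 <= h <= h by rewrite lexx ltW.
have h2 : 0 <= (0 : K) <= h by rewrite lexx ltW.
pose g (s : K) := f (x + h *: ei + s *: ej) - f (x + s *: ej).
pose dg s := partial j f (x + h *: ei + s *: ej) - partial j f (x + s *: ej).
have gd (s : K) : 0 <= s <= h -> is_derive s 1 g (dg s).
  move=> sh; apply: is_deriveB; apply: is_derive_coordinate_line; apply: fj.
    exact: near_x.
  by have := near_x 0 s; rewrite scale0r addr0; exact.
have [||c] := @mean_value_between K g dg 0 h.
- by rewrite (min_l h_ge0) (max_r h_ge0) => s /andP[/ltW s0 /ltW sh]; apply: gd; rewrite s0.
- by rewrite (min_l h_ge0) (max_r h_ge0); apply: continuous_is_derive => s /=;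
  rewrite in_itv /=; exact: gd.
rewrite (min_l h_ge0) (max_r h_ge0) => ch gE.
pose k (s : K) := partial j f (x + c *: ej + s *: ei).
pose dk s := partial i (partial j f) (x + c *: ej + s *: ei).
have kd (s : K) : 0 <= s <= h -> is_derive s 1 k (dk s).
  move=> sh; apply: is_derive_coordinate_line; apply: fij.
  exact: near_x'.
have [||c'] := @mean_value_between K k dk 0 h.
- by rewrite (min_l h_ge0) (max_r h_ge0) => s /andP[/ltW s0 /ltW sh]; apply: kd; rewrite s0.
- by rewrite (min_l h_ge0) (max_r h_ge0); apply: continuous_is_derive => s /=;
  rewrite in_itv /=; exact: kd.
rewrite (min_l h_ge0) (max_r h_ge0) => ch' kE.
exists (x + c *: ej + c' *: ei); first exact: near_x'.
have -> : second_increment f x (h *: delta_mx i 0) (h *: delta_mx j 0)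
    = g h - g 0.
  by rewrite /second_increment /g !scale0r !addr0 -/ei -/ej; ring.
rewrite gE subr0 mulrC; congr (_ * _).
transitivity (k h - k 0); first by rewrite /dg /k scale0r addr0 (addrAC x).
by rewrite kE subr0 mulrC.
Qed.

(** Both mixed derivatives are limits of the same quotient, since the second
    increment is symmetric in its two displacements. *)
Lemma partialC X f x i j : open X -> classC 2 X f -> X x ->
  partial i (partial j f) x = partial j (partial i f) x.
Proof.
have tri (e a b c : K) :
    `|a - b| <= e / 2 -> `|c - b| <= e / 2 -> `|a - c| <= e.
  move=> ab cb; apply: le_trans (ler_distD b a c) _.
  by rewrite [e]splitr lerD// distrC.
move=> oX f2 Xx.
suff main e : 0 < e ->
    `|partial i (partial j f) x - partial j (partial i f) x| <= e.
  apply/eqP; rewrite -subr_eq0 -normr_le0.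
  by apply/ler_addgt0Pl => e e0; rewrite addr0 main.
move=> e0.
have e20 : 0 < e / 2 by rewrite divr_gt0.
have : nbhs x [set w | [/\ X w,
    `|partial i (partial j f) x - partial i (partial j f) w| <= e / 2 &
    `|partial j (partial i f) x - partial j (partial i f) w| <= e / 2]].
  have cP k l : \forall w \near x,
      `|partial k (partial l f) x - partial k (partial l f) w| <= e / 2.
    have := classC_continuous (classC_partial k (classC_partial l f2)) Xx.
    by move=> /cvgrPdist_le; exact.
  apply: filter_app (cP j i); apply: filter_app (cP i j).
  by apply: filterS (open_nbhs_nbhs (conj oX Xx)) => w.
move=> /nbhs_closed_ball[r r0 rP].
pose h := r / 2; have h0 : 0 < h by rewrite divr_gt0.
have hr : 2 * h = r by rewrite mulrC divfK.
have [||w1 w1x] := @second_increment_partial f x i j h h0.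
- by move=> w; rewrite hr => /rP[Xw _ _]; exact: classC_derivable f2 Xw.
- move=> w; rewrite hr => /rP[Xw _ _].
  exact: classC_derivable (classC_partial j f2) Xw.
have [||w2 w2x] := @second_increment_partial f x j i h h0.
- by move=> w; rewrite hr => /rP[Xw _ _]; exact: classC_derivable f2 Xw.
- move=> w; rewrite hr => /rP[Xw _ _].
  exact: classC_derivable (classC_partial i f2) Xw.
move=> E1 E2.
have h_neq0 : h != 0 by rewrite gt_eqF.
rewrite second_incrementC E1 in E2.
have {E1 E2} E := mulfI h_neq0 (mulfI h_neq0 E2).
move: w1x w2x; rewrite hr => /rP[_ W1 _] /rP[_ _ W2].
by apply: tri W1 _; rewrite -E; exact: W2.
Qed.

Lemma hess_sym X f x : open X -> classC 2 X f -> X x -> (hess f x)^T = hess f x.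
Proof.
by move=> oX f2 Xx; apply/matrixP => i j; rewrite !mxE; exact: (@partialC X).
Qed.

End SmoothFunctions.

(** * Sums, products and derivatives along a vector field *)

Section SmoothAlgebra.
Context {K : realType} {d : nat}.
Implicit Types (X : set 'cV[K]_d) (f g : 'cV[K]_d -> K) (x y : 'cV[K]_d).

Lemma near_open_eq X f g x : open X -> {in X, f =1 g} -> X x ->
  \forall y \near x, f y = g y.
Proof.
move=> oX fg Xx; have := open_nbhs_nbhs (conj oX Xx).
by apply: filterS => y Xy; apply: fg; rewrite inE.
Qed.

(** The rules of differentiation only hold at the points of [X]; they are enough
    to identify smoothness classes because [X] is open. *)
Lemma classC_eq n X f g : open X -> {in X, f =1 g} ->
  classC n X f -> classC n X g.
Proof.
move=> oX; have gc f' g' x : {in X, f' =1 g'} -> X x ->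
    {for x, continuous f'} -> {for x, continuous g'}.
  move=> fg Xx f'c; rewrite /prop_for /continuous_at -(fg x) ?inE//.
  exact: cvg_trans (near_eq_cvg (near_open_eq oX fg Xx)) f'c.
elim: n f g => [|n IH] f g fg [fc fX].
  by split=> // x Xx; exact: gc fg Xx (fc _ Xx).
split=> [x Xx|i]; first exact: gc fg Xx (fc _ Xx).
have [fd fi] := fX i; split.
  move=> x Xx; apply: near_eq_derivable (fd _ Xx); exact: near_open_eq oX fg Xx.
apply: IH fi => x; rewrite inE => Xx.
by apply: near_eq_derive; exact: near_open_eq oX fg Xx.
Qed.

Lemma classC_cst n X (a : K) : classC n X (fun=> a).
Proof.
elim: n a => [|n IH] a; (split; first by move=> x _; exact: cst_continuous).
  by [].
move=> i; split; first by move=> x _; exact: derivable_cst.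
have -> : partial i (fun=> a) = fun=> 0.
  by apply/funext => x; exact: derive_cst.
exact: IH.
Qed.

Lemma classCD n X f g : open X -> classC n X f -> classC n X g ->
  classC n X (fun x => f x + g x).
Proof.
move=> oX; elim: n f g => [|n IH] f g [fc fX] [gc gX].
all: split; first by move=> x Xx; apply: continuousD; [exact: fc|exact: gc].
  by [].
move=> i; have [fd fi] := fX i; have [gd gi] := gX i; split.
  by move=> x Xx; apply: derivableD; [exact: fd|exact: gd].
apply: classC_eq oX _ (IH _ _ fi gi) => x; rewrite inE => Xx.
by rewrite /partial deriveD//; [exact: fd|exact: gd].
Qed.

Lemma classCM n X f g : open X -> classC n X f -> classC n X g ->
  classC n X (fun x => f x * g x).
Proof.
move=> oX; elim: n f g => [|n IH] f g fC gC.
all: split; first by move=> x Xx; apply: continuousM;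
  [exact: classC_continuous fC Xx|exact: classC_continuous gC Xx].
  by [].
move=> i; split.
  by move=> x Xx; apply: derivableM;
    [exact: classC_derivable fC Xx|exact: classC_derivable gC Xx].
have := classCD oX (IH _ _ (classCW fC) (classC_partial i gC))
                   (IH _ _ (classCW gC) (classC_partial i fC)).
apply: classC_eq oX _ => x; rewrite inE => Xx.
by rewrite /partial deriveM//;
    [exact: classC_derivable fC Xx|exact: classC_derivable gC Xx].
Qed.

Lemma classC_sum (I : Type) (r : seq I) n X (f : I -> 'cV[K]_d -> K) :
  open X -> (forall i, classC n X (f i)) ->
  classC n X (fun x => \sum_(i <- r) f i x).
Proof.
move=> oX fC; elim: r => [|i r IH].
  by apply: classC_eq oX _ (classC_cst n X 0) => x _; rewrite big_nil.
by apply: classC_eq oX _ (classCD oX (fC i) IH) => x _; rewrite big_cons.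
Qed.

Lemma derivable_coord x (i j : 'I_d) :
  is_derive x (delta_mx i 0) (fun y : 'cV[K]_d => y j 0) (i == j)%:R.
Proof.
have E : (fun h : K => h^-1 *: ((h *: delta_mx i 0 + x : 'cV[K]_d) j 0 - x j 0))
    @ 0^' --> ((i == j)%:R : K).
  apply: (@cvg_trans _ ((fun=> (i == j)%:R : K) @ 0^')); last exact: cvg_cst.
  apply: near_eq_cvg; near=> h.
  rewrite !mxE addrK eqxx andbT eq_sym [RHS]mulrA mulVf ?mul1r//.
  by near: h; exact: nbhs_dnbhs_neq.
by split; [exact: cvgP E|exact: cvg_lim E].
Unshelve. all: by end_near. Qed.

Lemma classC_coord n X (j : 'I_d) : classC n X (fun y => y j 0).
Proof.
case: n => [|n]; split=> //; try by move=> x _; exact: coord_continuous.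
move=> i; split=> [x _|]; first by have [] := derivable_coord x i j.
have -> : partial i (fun y => y j 0) = fun=> (i == j)%:R.
  by apply/funext => x; have [] := derivable_coord x i j.
exact: classC_cst.
Qed.

(** The Lie derivative: along a solution of the differential equation with right
    hand side [V], it is the time derivative of [f]. *)
Definition lie (V : 'I_d -> 'cV[K]_d -> K) f x := \sum_i V i x * partial i f x.

Lemma classC_lie n X (V : 'I_d -> 'cV[K]_d -> K) f : open X ->
  (forall i, classC n X (V i)) -> classC n.+1 X f -> classC n X (lie V f).
Proof.
move=> oX VC fC; apply: classC_sum => // i.
by apply: classCM => //; exact: classC_partial.
Qed.

End SmoothAlgebra.

(** * Local Lipschitz and Taylor estimates *)

Section LocalEstimates.
Context {K : realType} {d : nat}.
Implicit Types (X : set 'cV[K]_d) (f g : 'cV[K]_d -> K) (x y : 'cV[K]_d).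

(** Two points in a ball of radius [r / 3] are joined by a coordinatewise path
    that stays in the ball of radius [r]. *)
Lemma local_lipschitz X f x : open X -> classC 1 X f -> X x ->
  exists L : K, exists2 r, 0 < r & forall y z, `|y - x| <= r -> `|z - x| <= r ->
    `|f z - f y| <= L * `|z - y|.
Proof.
move=> oX f1 Xx.
pose M := \sum_i (`|partial i f x| + 1).
have : \forall w \near x, X w /\ forall i, `|partial i f w| <= M.
  have PM : \forall w \near x, forall i, `|partial i f w| <= M.
    refine (@filter_forall _ 'I_d (fun i w => `|partial i f w| <= M)
      (nbhs x) _ _) => i.
    have := classC_continuous (classC_partial i f1) Xx.
    move=> /cvgrPdist_le/(_ _ ltr01); apply: filterS => w; rewrite distrC => le1.
    have le2 : `|partial i f w| <= `|partial i f x| + 1.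
      rewrite -(subrK (partial i f x) (partial i f w)).
      by rewrite (le_trans (ler_normD _ _))// addrC lerD2l.
    rewrite (le_trans le2)// /M (bigD1 i)//= lerDl sumr_ge0//.
  by apply: filterS2 (open_nbhs_nbhs (conj oX Xx)) PM => w.
move=> /nbhs_closed_ball[r r0 rP].
exists (d%:R * M); exists (r / 3) => [|y z yx zx]; first exact: divr_gt0.
have near_x w : `|w - y| <= `|z - y| -> `|w - x| <= r.
  move=> wy; rewrite -(subrKA y) (le_trans (ler_normD _ _))//.
  have : `|z - y| <= `|z - x| + `|y - x|.
    by rewrite -(subrKA x) (le_trans (ler_normD _ _))// (distrC x).
  by move: wy yx zx; lra.
have := @increment_partial_le K d f y z (fun=> 0) M.
under eq_bigr do rewrite mul0r.
rewrite big1// subr0 mulrA; apply.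
  by move=> w i /near_x/rP[Xw _]; exact: classC_derivable f1 Xw.
by move=> w i /near_x/rP[_ wM]; rewrite subr0.
Qed.

(** On the way from [y] to [z] the partial derivatives differ from those at [y]
    by at most a multiple of [`|z - y|], hence the square. *)
Lemma local_taylor X f x : open X -> classC 2 X f -> X x ->
  exists L : K, exists2 r, 0 < r & forall y z, `|y - x| <= r -> `|z - x| <= r ->
    `|f z - f y - \sum_i partial i f y * (z i 0 - y i 0)| <= L * `|z - y| ^+ 2.
Proof.
move=> oX f2 Xx.
have [L [r r0 rP]] : exists L : K, exists2 r, 0 < r & forall y z,
    `|y - x| <= r -> `|z - x| <= r ->
    X y /\ forall i, `|partial i f z - partial i f y| <= L * `|z - y|.
  have Li (i : 'I_d) := local_lipschitz oX (classC_partial i f2) Xx.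
  have /choice[L /choice[r rP]] : forall i : 'I_d, exists L : K, exists r : K,
      0 < r /\ forall y z, `|y - x| <= r -> `|z - x| <= r ->
      `|partial i f z - partial i f y| <= L * `|z - y|.
    by move=> i; have [L [r r0 rP]] := Li i; exists L, r.
  have : \forall w \near x, X w /\ forall i, `|w - x| <= r i.
    have wr : \forall w \near x, forall i, `|w - x| <= r i.
      refine (@filter_forall _ 'I_d (fun i w => `|w - x| <= r i)
        (nbhs x) _ _) => i.
      have [ri0 _] := rP i.
      have /cvgrPdist_le/(_ _ ri0) : (fun w : 'cV[K]_d => w) @ x --> x by exact: cvg_id.
      by apply: filterS => w; rewrite distrC.
    by apply: filterS2 (open_nbhs_nbhs (conj oX Xx)) wr => w.
  move=> /nbhs_closed_ball[e e0 eP].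
  exists (\sum_i `|L i|), e => // y z /eP[Xy yr] /eP[_ zr]; split=> // i.
  have [_ /(_ y z (yr i) (zr i))/le_trans] := rP i; apply.
  rewrite ler_wpM2r// (bigD1 i)//= (le_trans (ler_norm _))//.
  by rewrite lerDl sumr_ge0.
exists (d%:R * `|L|); exists (r / 3) => [|y z yx zx]; first exact: divr_gt0.
have near_x w : `|w - y| <= `|z - y| -> `|w - x| <= r.
  move=> wy; rewrite -(subrKA y) (le_trans (ler_normD _ _))//.
  have : `|z - y| <= `|z - x| + `|y - x|.
    by rewrite -(subrKA x) (le_trans (ler_normD _ _))// (distrC x).
  by move: wy yx zx; lra.
have yr : `|y - x| <= r by apply: near_x; rewrite subrr normr0.
rewrite expr2 -mulrA (mulrA `|L|).
apply: increment_partial_le => w i wy.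
  have [Xw _] := rP w w (near_x _ wy) (near_x _ wy).
  exact: classC_derivable f2 Xw.
have [_ /(_ i)/le_trans] := rP y w yr (near_x _ wy); apply.
by rewrite (le_trans (ler_wpM2r _ (ler_norm _)))// ler_wpM2l.
Qed.

Section Filtered.
Context {T : Type} (F : set_system T) {FF : Filter F}.
Variables (X : set 'cV[K]_d) (x : 'cV[K]_d) (b c : T -> 'cV[K]_d).
Hypotheses (oX : open X) (Xx : X x) (bx : b @ F --> x) (cx : c @ F --> x).

Lemma near_norm_sub_le (u : T -> 'cV[K]_d) r : u @ F --> x -> 0 < r ->
  \forall t \near F, `|u t - x| <= r.
Proof.
move=> /cvgrPdist_le ux /ux; apply: filterS => t; rewrite distrC; exact.
Qed.

Lemma dominated_classC n f : classC n X f ->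
  dominated F (fun=> 1) (fun t => f (c t)).
Proof.
move=> fC; apply: (cvg_is_dominated (a := f x)).
by apply: continuous_cvg cx; exact: classC_continuous fC Xx.
Qed.

Lemma dominated_lipschitz f (g : T -> K) : classC 1 X f ->
  dominated F g (fun t => c t - b t) ->
  dominated F g (fun t => f (c t) - f (b t)).
Proof.
move=> f1 [C cb]; have [L [r r0 rP]] := local_lipschitz oX f1 Xx.
exists (`|L| * C); near=> t; rewrite -mulrA.
apply: le_trans (rP _ _ _ _) _.
- by near: t; exact: near_norm_sub_le.
- by near: t; exact: near_norm_sub_le.
rewrite (le_trans (ler_wpM2r _ (ler_norm _)))// ler_wpM2l//.
by near: t.
Unshelve. all: by end_near. Qed.

Lemma dominated_taylor f (g : T -> K) : classC 2 X f ->
  dominated F g (fun t => c t - b t) ->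
  dominated F (fun t => g t ^+ 2) (fun t => f (c t) - f (b t)
    - \sum_i partial i f (b t) * (c t i 0 - b t i 0)).
Proof.
move=> f2 [C cb]; have [L [r r0 rP]] := local_taylor oX f2 Xx.
exists (`|L| * C ^+ 2); near=> t; rewrite -mulrA -exprMn.
apply: le_trans (rP _ _ _ _) _.
- by near: t; exact: near_norm_sub_le.
- by near: t; exact: near_norm_sub_le.
rewrite (le_trans (ler_wpM2r _ (ler_norm _))) ?exprn_ge0// ler_wpM2l//.
have cbt : `|c t - b t| <= C * g t by near: t.
apply: lerXn2r => //; rewrite nnegrE//.
exact: le_trans cbt.
Unshelve. all: by end_near. Qed.

End Filtered.
End LocalEstimates.

(** * The averaged gradient *)

Section AverageVectorField.
Context {K : realType} {d : nat}.
Implicit Types (X : set 'cV[K]_d) (f : 'cV[K]_d -> K) (x y z : 'cV[K]_d).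

Definition chord x y (s : K) : 'cV[K]_d := (1 - s) *: x + s *: y.

Lemma chordE x y (s : K) : chord x y s = x + s *: (y - x).
Proof. by rewrite /chord scalerBl scale1r scalerBr -!addrA (addrC (s *: y)). Qed.

Lemma is_derive_chord x y (s : K) : is_derive s 1 (chord x y) (y - x).
Proof.
have -> : chord x y = fun s => x + s *: (y - x).
  by apply/funext => t; exact: chordE.
have E := @derive_id K 'cV[K]_d (x + s *: (y - x)) (y - x).
rewrite -[X in is_derive _ _ _ X]E.
apply: (@is_derive_line K 'cV[K]_d 'cV[K]_d id).
exact: derivable_id.
Qed.

Lemma chord_continuous x y : continuous (chord x y).
Proof.
move=> s; apply/differentiable_continuous/derivable1_diffP.
by have [] := is_derive_chord x y s.
Qed.

Lemma within_chord X n f x y : classC n X f -> admissible X x y ->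
  {within `[0, 1], continuous (fun s => f (chord x y s))}.
Proof.
move=> fC xy; apply: continuous_in_subspaceT => s; rewrite inE /= in_itv => s01.
apply: (@continuous_comp _ _ _ (chord x y) f); first exact: chord_continuous.
exact: classC_continuous fC (xy _ s01).
Qed.

Lemma continuous_lincomb (T : topologicalType) (b : 'I_d -> K)
    (u : 'I_d -> T -> K) (t : T) :
  (forall i, {for t, continuous (u i)}) ->
  {for t, continuous (fun s => \sum_i b i * u i s)}.
Proof.
move=> uc; elim: (index_enum _) => [|i r IH].
  rewrite (_ : (fun s => _) = cst 0); first exact: cst_continuous.
  by apply/funext => s; rewrite big_nil.
rewrite (_ : (fun s => _) = (fun s => b i * u i s) \+
    (fun s => \sum_(j <- r) b j * u j s)).
  apply: continuousD => //.
  by apply: continuousM; [exact: cst_continuous|exact: uc].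
by apply/funext => s; rewrite big_cons.
Qed.

(** Replacing the integral by the increment of an antiderivative makes the mean
    value theorem applicable to the averaged gradient. *)
Lemma avf_antiderivative X f x y (i : 'I_d) : classC 1 X f -> admissible X x y ->
  exists U : K -> K, [/\ forall s : K, 0 < s < 1 ->
      is_derive s 1 U (partial i f (chord x y s)),
    {within `[0, 1], continuous U} & avf f x y i 0 = U 1 - U 0].
Proof.
move=> f1 xy; have fiC := classC_partial i f1.
pose u s := partial i f (chord x y s).
have uc : {within `[0, 1], continuous u} := within_chord fiC xy.
have ui : lebesgue_measure.-integrable `[0, 1] (EFin \o u).
  by apply: continuous_compact_integrable uc; exact: segment_compact.
exists (fun s => \int[lebesgue_measure]_(t in `[0, s]) u t)%R; split.
- move=> s /andP[s0 s1].
  have us : {for s, continuous u}.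
    apply: (@continuous_comp _ _ _ (chord x y) (partial i f)).
      exact: chord_continuous.
    by apply: classC_continuous fiC (xy _ _); rewrite !ltW.
  have [Ud UE] := continuous_FTC1_closed s1 ui s0 us.
  by split; [exact: Ud|rewrite -derive1E UE].
- exact: parameterized_integral_continuous ler01 ui.
rewrite mxE set_itv1 Rintegral_set1 subr0.
by congr Rintegral; apply/funext => s; rewrite mxE.
Qed.

(** The antiderivatives of the averaged partial derivatives, combined with the
    coefficients [b], and [q] have derivatives at distance at most [e]; by the
    mean value theorem so are their increments over the unit interval. *)
Lemma avf_approx X f x y (b : 'I_d -> K) (q dq : K -> K) (e : K) :
  classC 1 X f -> admissible X x y ->
  (forall s : K, 0 < s < 1 -> is_derive s 1 q (dq s)) ->
  {within `[0, 1], continuous q} ->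
  (forall s : K, 0 <= s <= 1 ->
     `|\sum_i b i * partial i f (chord x y s) - dq s| <= e) ->
  `|\sum_i b i * avf f x y i 0 - (q 1 - q 0)| <= e.
Proof.
move=> f1 xy qd qc qe.
have /choice[U UP] := fun i => avf_antiderivative i f1 xy.
pose g s := \sum_i b i * U i s - q s.
have -> : \sum_i b i * avf f x y i 0 - (q 1 - q 0) = g 1 - g 0.
  under eq_bigr => i _ do (have [_ _ ->] := UP i; rewrite mulrBr).
  by rewrite sumrB /g; ring.
have gd (s : K) : 0 < s < 1 ->
    is_derive s 1 g (\sum_i b i * partial i f (chord x y s) - dq s).
  move=> s01; apply: is_deriveB; last exact: qd.
  have -> : (fun s => \sum_i b i * U i s) = \sum_i (fun s => b i * U i s).
    by apply/funext => t; rewrite fct_sumE.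
  apply: is_derive_sum => i; apply: (@is_deriveZ _ _ _ (U i)).
  by have [Ud _ _] := UP i; exact: Ud.
have gc : {within `[0, 1], continuous g}.
  move=> s; apply: (@continuousB K K); last exact: qc.
  by apply: continuous_lincomb => i; have [_ Uc _] := UP i; exact: Uc.
have := @derive_le_increment K g
  (fun s => \sum_i b i * partial i f (chord x y s) - dq s) 0 1 e.
rewrite (min_l ler01) (max_r ler01) subr0 normr1 mulr1; exact.
Qed.

(** The chain rule along the chord is the case without error of
    [avf_approx]. *)
Lemma avf_discrete_gradient X f x y : open X -> classC 1 X f ->
  admissible X x y ->
  f y - f x = \sum_i (y i 0 - x i 0) * avf f x y i 0.
Proof.
move=> oX f1 xy; apply/esym/eqP; rewrite -subr_eq0 -normr_le0.
have c1 : chord x y 1 = y by rewrite /chord subrr scale0r add0r scale1r.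
have c0 : chord x y 0 = x by rewrite /chord subr0 scale0r addr0 scale1r.
have := @avf_approx X f x y (fun i => y i 0 - x i 0) (fun s => f (chord x y s))
  (fun s => \sum_i partial i f (chord x y s) * (y - x) i 0) 0.
rewrite c0 c1; apply => //.
- move=> s s01; apply: is_derive_comp oX f1 _ (is_derive_chord x y s).
  by apply: xy; case/andP: s01 => /ltW-> /ltW->.
- exact: within_chord f1 xy.
move=> s s01; under [X in _ - X]eq_bigr do rewrite !mxE mulrC.
by rewrite subrr normr0.
Qed.

End AverageVectorField.

(** * Dissipation of energy *)

Section QuadraticForms.
Context {K : realType} {d : nat}.
Implicit Types (A B S : 'M[K]_d) (v : 'cV[K]_d).

Lemma skew_symmetric_form A v : skew_symmetric A -> (v^T *m A *m v) 0 0 = 0.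
Proof.
move=> skA; have E : (v^T *m A *m v)^T 0 0 = (v^T *m A *m v) 0 0 by rewrite mxE.
move: E; rewrite !trmx_mul trmxK skA mulNmx mulmxN mulmxA mxE => E.
by move: E; set a := (_ *m _ *m _) 0 0 => E; lra.
Qed.

Lemma sym_psd_sum (I : finType) (a : I -> K) (A : I -> 'M[K]_d) :
  (forall j, 0 <= a j) -> (forall j, sym_psd (A j)) ->
  sym_psd (\sum_j a j *: A j).
Proof.
move=> a0 Apsd; split=> [|v].
  rewrite linear_sum/=; apply: eq_bigr => j _.
  by rewrite linearZ/=; have [-> _] := Apsd j.
rewrite mulmx_sumr mulmx_suml summxE sumr_ge0// => j _.
rewrite -scalemxAr -scalemxAl mxE mulr_ge0//.
by have [_] := Apsd j; exact.
Qed.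

Lemma sym_psd_congruence A B : sym_psd A -> sym_psd (B^T *m A *m B).
Proof.
move=> [AT A0]; split=> [|v]; first by rewrite !trmx_mul trmxK AT mulmxA.
by have := A0 (B *m v); rewrite trmx_mul !mulmxA.
Qed.

(** With [A = R], the coefficients of [h], [h ^+ 2] and [h ^+ 3] are the matrices
    whose weighted sums the conditions on the method prescribe. *)
Lemma congruence_expansion A (M N : 'M[K]_d) (h : K) :
  (1%:M + h *: M + h ^+ 2 *: N)^T *m A *m (1%:M + h *: M + h ^+ 2 *: N) =
  A + h *: (M^T *m A + A *m M)
    + h ^+ 2 *: (M^T *m A *m M + N^T *m A + A *m N)
    + h ^+ 3 *: (M^T *m A *m N + N^T *m A *m M) + h ^+ 4 *: (N^T *m A *m N).
Proof.
have -> : (1%:M + h *: M + h ^+ 2 *: N)^T = 1%:M + h *: M^T + h ^+ 2 *: N^T.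
  by rewrite !linearD/= !linearZ/= trmx1.
rewrite !mulmxDl !mulmxDr !mul1mx !mulmx1.
rewrite -!scalemxAr -!scalemxAl.
set a := M^T *m A; set b := A *m M; set c := a *m M; set e := N^T *m A.
set f := A *m N; set g := a *m N; set i := e *m M; set j := e *m N.
by apply/matrixP => k l; rewrite !mxE; ring.
Qed.

(** Each word carries the sign given by the parity of its number of [B]s.  With
    [A = J] and [B = R] the four groups are [T0], [T2], [T1] and [T3]. *)
Lemma alternating_words_expansion A B S :
  A *m S *m A *m S *m A
  + (B *m S *m B *m S *m A + B *m S *m A *m S *m B + A *m S *m B *m S *m B)
  - (B *m S *m A *m S *m A + A *m S *m B *m S *m A + A *m S *m A *m S *m B)
  - B *m S *m B *m S *m B
  = (A - B) *m S *m (A - B) *m S *m (A - B).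
Proof.
rewrite !(mulmxBl, mulmxBr).
move: (A *m S *m A *m S *m A) (B *m S *m B *m S *m A) (B *m S *m A *m S *m B).
move: (A *m S *m B *m S *m B) (B *m S *m A *m S *m A) (A *m S *m B *m S *m A).
move: (A *m S *m A *m S *m B) (B *m S *m B *m S *m B) => a b c e f g i j.
by apply/matrixP => k l; rewrite !mxE; ring.
Qed.

Lemma skew_symmetricB A B : skew_symmetric A -> skew_symmetric B ->
  skew_symmetric (A - B).
Proof. by move=> skA skB; rewrite /skew_symmetric linearB/= skA skB opprD. Qed.

Lemma skew_symmetricZ (k : K) A : skew_symmetric A -> skew_symmetric (k *: A).
Proof. by move=> skA; rewrite /skew_symmetric linearZ/= skA scalerN. Qed.

End QuadraticForms.

Section EnergyBalance.
Context {K : realType} {d : nat}.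
Variables (X : set 'cV[K]_d) (H : 'cV[K]_d -> K) (J R : 'M[K]_d).
Hypotheses (oX : open X) (JT : skew_symmetric J) (RT : R^T = R).

(** Transposition reverses a word and changes its sign when it contains an odd
    number of [J]s, as those of [T0] and [T2] do; both families are closed under
    reversal. *)
Lemma Jbar_skew x y h : classC 2 X H -> X (midpoint x y) ->
  skew_symmetric (Jbar H J R x y h).
Proof.
move=> H2 Xm; apply: skew_symmetricB JT (skew_symmetricZ _ _).
have ST := hess_sym oX H2 Xm.
rewrite /skew_symmetric /T0 /T2; move: (hess H _) ST => S ST.
rewrite !linearD/= !trmx_mul JT RT ST !mulmxA !(mulNmx, mulmxN) !opprK.
by congr (_ + _); rewrite addrC addrA addrAC.
Qed.

(** Multiply the step by the averaged gradient: the left hand side is the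
    increment of [H], and the skew-symmetric part drops out. *)
Lemma energy_balance (Jb Rb : 'cV[K]_d -> 'cV[K]_d -> K -> 'M[K]_d) x y h :
  classC 1 X H -> skew_symmetric (Jb x y h) ->
  avf_step X H (fun x y h => Jb x y h - Rb x y h) x y h ->
  H y - H x = - (h * ((avf H x y)^T *m Rb x y h *m avf H x y) 0 0).
Proof.
move=> H1 skJ [xy h0 E]; rewrite (avf_discrete_gradient oX H1 xy).
set v := avf H x y in E *.
have {}E : y - x = h *: ((Jb x y h - Rb x y h) *m v).
  by rewrite -E scalerA mulfV ?gt_eqF// scale1r.
have -> : \sum_i (y i 0 - x i 0) * v i 0 = (v^T *m (y - x)) 0 0.
  by rewrite mxE; apply: eq_bigr => i _; rewrite !mxE mulrC.
rewrite E -scalemxAr mulmxA mulmxBr mulmxBl.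
have := skew_symmetric_form v skJ.
move: (v^T *m Jb x y h *m v) (v^T *m Rb x y h *m v) => a b a0.
by rewrite !mxE a0 sub0r mulrN.
Qed.

End EnergyBalance.

(** * Expansion of the matrix of the method *)

Section Neighbourhoods.
Context {K : realType} {d : nat}.
Context {T : Type} (F : set_system T) {FF : Filter F}.
Variables (X : set 'cV[K]_d) (x : 'cV[K]_d) (b c : T -> 'cV[K]_d).
Hypotheses (oX : open X) (Xx : X x) (bx : b @ F --> x) (cx : c @ F --> x).

Lemma chord_dist_le y z (r s : K) : 0 <= s <= 1 ->
  `|y - x| <= r -> `|z - x| <= r -> `|chord y z s - x| <= r.
Proof.
move=> /andP[s0 s1] yr zr.
have -> : chord y z s - x = (1 - s) *: (y - x) + s *: (z - x).
  by rewrite /chord; apply/colP => i; rewrite !mxE; ring.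
rewrite (le_trans (ler_normD _ _))// !normrZ !ger0_norm ?subr_ge0//.
have s1' : 0 <= 1 - s by rewrite subr_ge0.
have := lerD (ler_wpM2l s1' yr) (ler_wpM2l s0 zr); move=> /le_trans; apply.
by rewrite -mulrDl subrK mul1r.
Qed.

(** Balls are convex. *)
Lemma near_admissible : \forall t \near F, admissible X (b t) (c t).
Proof.
have [r r0 rX] := nbhs_closed_ball (open_nbhs_nbhs (conj oX Xx)).
apply: filterS2 (near_norm_sub_le bx r0) (near_norm_sub_le cx r0) => t br cr.
by move=> s s01; apply: rX; exact: chord_dist_le.
Qed.

Lemma midpoint_cvg : midpoint (b t) (c t) @[t --> F] --> x.
Proof.
have -> : x = midpoint x x.
  by rewrite /midpoint; apply/colP => i; rewrite !mxE; field.
rewrite /midpoint; apply: cvgZr; exact: cvgD.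
Qed.

Lemma dominated_hess n (H : 'cV[K]_d -> K) :
  classC n.+2 X H -> dominated F (fun=> 1) (fun t => hess H (c t)).
Proof.
move=> HC; apply: dominated_mx => [|i j].
  by apply: nearW => t; exact: ler01.
have HijC := classC_partial j (classC_partial i HC).
by apply: dominated_near (dominated_classC Xx cx HijC); apply: nearW => t; rewrite mxE.
Qed.

(** Continuity relative to the admissible pairs suffices, because all pairs near
    the diagonal point [(x, x)] are admissible. *)
Lemma dominated_within (V : normedModType K) (f : 'cV[K]_d * 'cV[K]_d -> V) :
  {within [set p | admissible X p.1 p.2], continuous f} ->
  dominated F (fun=> 1) (fun t => f (b t, c t)).
Proof.
move=> fc; exists (`|f (x, x)| + 1).
have xx : [set p | admissible X p.1 p.2] (x, x).
  move=> s _ /=; rewrite -scalerDl subrK scale1r; exact: Xx.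
have /(_ _ xx)/cvgrPdist_le/(_ _ ltr01) := (subspace_continuousP _ _).1 fc.
move=> near_xx.
have bcx : (b t, c t) @[t --> F] --> (x, x).
  exact: (cvg_pair bx cx).
have := bcx _ near_xx; rewrite /from_subspace /=.
apply: filterS2 near_admissible => t adm /(_ adm) /= le1.
rewrite mulr1 -[f (b t, c t)](subrK (f (x, x))).
by rewrite (le_trans (ler_normD _ _))// addrC lerD2l distrC.
Qed.

End Neighbourhoods.

Section ModifiedMatrix.
Context {K : realType} {d : nat}.
Variables (X : set 'cV[K]_d) (H : 'cV[K]_d -> K) (J R : 'M[K]_d).
Variables (m : nat) (alpha : 'I_m -> K).
Variables (C D : 'I_m -> 'cV[K]_d -> 'cV[K]_d -> 'M[K]_d).
Hypothesis alpha1 : \sum_(j < m) alpha j = 1.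
Hypothesis order1 : forall x y, admissible X x y ->
  \sum_(j < m) alpha j *: ((C j x y)^T *m R + R *m C j x y) = 0.
Hypothesis order2 : forall x y, admissible X x y ->
  \sum_(j < m) alpha j *: ((C j x y)^T *m R *m C j x y
                              + (D j x y)^T *m R + R *m D j x y)
     = - (12^-1 *: (T1 H J R (midpoint x y) + T3 H R (midpoint x y))).
Hypothesis order3 : forall x y, admissible X x y ->
  \sum_(j < m) alpha j *: ((C j x y)^T *m R *m D j x y
                              + (D j x y)^T *m R *m C j x y) = 0.

Definition remainder x y : 'M[K]_d :=
  \sum_(j < m) alpha j *: ((D j x y)^T *m R *m D j x y).

Lemma Rbar_expansion x y h : admissible X x y ->
  Rbar R alpha C D x y h
  = R - (h ^+ 2 / 12) *: (T1 H J R (midpoint x y) + T3 H R (midpoint x y))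
    + h ^+ 4 *: remainder x y.
Proof.
move=> xy; rewrite /Rbar /Psi /remainder.
under eq_bigr do rewrite congruence_expansion 4!scalerDr.
rewrite !big_split/= -scaler_suml alpha1 scale1r.
have swap (k : K) (A : 'I_m -> 'M[K]_d) :
    \sum_(j < m) alpha j *: (k *: A j) = k *: \sum_(j < m) alpha j *: A j.
  by rewrite scaler_sumr; apply: eq_bigr => j _; rewrite !scalerA mulrC.
rewrite !swap order1// order2// order3// !scaler0 !addr0.
by rewrite scalerN scalerA.
Qed.

Lemma modified_expansion x y h : admissible X x y ->
  Jbar H J R x y h - Rbar R alpha C D x y h
  = (J - R) - (h ^+ 2 / 12) *: ((J - R) *m hess H (midpoint x y) *m (J - R)
      *m hess H (midpoint x y) *m (J - R)) - h ^+ 4 *: remainder x y.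
Proof.
move=> xy; rewrite Rbar_expansion// /Jbar -alternating_words_expansion.
rewrite /T0 /T1 /T2 /T3; move: (hess H _) => S.
move: (J *m S *m J *m S *m J) (R *m S *m R *m S *m R) (remainder x y).
move: (R *m S *m R *m S *m J + _ + _) (R *m S *m J *m S *m J + _ + _) => a b c e f.
by apply/matrixP => i j; rewrite !mxE; ring.
Qed.

Section Filtered.
Context {T : Type} (F : set_system T) {FF : Filter F}.
Variables (x : 'cV[K]_d) (b c : T -> 'cV[K]_d).
Hypotheses (oX : open X) (Xx : X x) (bx : b @ F --> x) (cx : c @ F --> x).
Hypothesis DC : forall j, {within [set p | admissible X p.1 p.2],
     continuous (fun p : 'cV[K]_d * 'cV[K]_d => D j p.1 p.2)}.

Lemma dominated_remainder : dominated F (fun=> 1) (fun t => remainder (b t) (c t)).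
Proof.
apply: dominated_sum => j.
have Dj : dominated F (fun=> 1) (fun t => D j (b t) (c t)).
  exact: (dominated_within oX Xx bx cx (@DC j)).
have DjT : dominated F (fun=> 1) (fun t => (D j (b t) (c t))^T).
  apply: dominated_mx => [|k l]; first by apply: nearW => t; exact: ler01.
  by apply: dominated_near (dominated_coord l k Dj); apply: nearW => t; rewrite mxE.
apply: bounded_scale; first exact: dominated_cst.
by do 2?[apply: bounded_mulmx => //]; exact: dominated_cst.
Qed.

Lemma dominated_correction n : classC n.+2 X H -> dominated F (fun=> 1)
  (fun t => (J - R) *m hess H (midpoint (b t) (c t)) *m (J - R)
      *m hess H (midpoint (b t) (c t)) *m (J - R)).
Proof.
move=> HC; have Sm : dominated F (fun=> 1)
    (fun t => hess H (midpoint (b t) (c t))).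
  exact: (dominated_hess Xx (midpoint_cvg bx cx) HC).
by do 4?[apply: bounded_mulmx => //]; exact: dominated_cst.
Qed.

(** In the expansion everything but [J - R] is a bounded matrix times a positive
    power of the step size. *)
Lemma modified_cvg n (h : T -> K) : classC n.+2 X H -> h @ F --> 0 ->
  Jbar H J R (b t) (c t) (h t) - Rbar R alpha C D (b t) (c t) (h t)
    @[t --> F] --> J - R.
Proof.
move=> HC h0.
have hX k : (h t ^+ k.+1) @[t --> F] --> (0 : K).
  elim: k => [|k IH]; first exact: h0.
  rewrite (_ : (fun t => _) = (fun t => h t *: h t ^+ k.+1)).
    exact: cvg_scale_dominated h0 (cvg_is_dominated IH).
  by apply/funext => t; rewrite exprS.
have h2 : (h t ^+ 2 / 12) @[t --> F] --> (0 : K).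
  rewrite (_ : (fun t => _) = (fun t => h t ^+ 2 *: (12^-1 : K^o))) //.
  exact: cvg_scale_dominated (hX _) (dominated_cst F _).
pose M t := (J - R) *m hess H (midpoint (b t) (c t)) *m (J - R)
  *m hess H (midpoint (b t) (c t)) *m (J - R).
have lim0 : (J - R) - (h t ^+ 2 / 12) *: M t
    - h t ^+ 4 *: remainder (b t) (c t) @[t --> F] --> (J - R) - 0 - 0.
  apply: cvgB; last exact: cvg_scale_dominated (hX _) dominated_remainder.
  apply: cvgB; first exact: cvg_cst.
  exact: cvg_scale_dominated h2 (dominated_correction HC).
rewrite !subr0 in lim0; apply: cvg_trans lim0; apply: near_eq_cvg.
apply: filterS (near_admissible oX Xx bx cx) => t adm.
by rewrite modified_expansion.
Qed.

End Filtered.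
End ModifiedMatrix.

(** * Taylor expansion on a step *)

Section Taylor.
Context {K : realType}.

Definition taylor (a : nat -> K) (n : nat) (r : K) : K :=
  \sum_(k < n) a k * r ^+ k / k`!%:R.

Lemma taylorS a n r : taylor a n.+1 r = taylor a n r + a n * r ^+ n / n`!%:R.
Proof. by rewrite /taylor big_ord_recr. Qed.

Lemma taylor_at0 a n : taylor a n.+1 0 = a 0%N.
Proof.
rewrite /taylor big_ord_recl expr0 mulr1 fact0 divr1 big1 ?addr0// => k _.
by rewrite exprS mul0r mulr0 mul0r.
Qed.

Lemma is_derive_taylor a n (m s : K) :
  is_derive s 1 (fun s => taylor a n.+1 (s - m)) (taylor (a \o S) n (s - m)).
Proof.
elim: n => [|n IH].
  have -> : (fun s => taylor a 1 (s - m)) = fun=> a 0%N.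
    by apply/funext => t; rewrite taylorS /taylor big_ord0 add0r expr0 mulr1 fact0 divr1.
  by rewrite /taylor big_ord0; exact: is_derive_cst.
have -> : (fun s => taylor a n.+2 (s - m)) = (fun s => taylor a n.+1 (s - m)) \+
    (fun s => (a n.+1 / n.+1`!%:R) *: (s - m) ^+ n.+1).
  by apply/funext => t; rewrite /= taylorS; congr (_ + _); rewrite mulrAC.
rewrite taylorS; apply: is_deriveD.
have idm : is_derive s 1 (fun s : K => s - m) 1.
  by rewrite -[X in is_derive _ _ _ X]subr0; exact: is_deriveB.
have dX : is_derive s 1 (fun s : K => (s - m) ^+ n.+1) (n.+1%:R * (s - m) ^+ n).
  have E := @is_deriveX _ _ _ n.+1 s 1 1 idm.
  rewrite [X in is_derive _ _ _ X]mulr1 in E.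
  rewrite (_ : (fun s => (s - m) ^+ n.+1) = (fun s => s - m) ^+ n.+1); first exact: E.
  by apply/funext => r; rewrite exprfctE.
rewrite (_ : (a \o S) n * (s - m) ^+ n / n`!%:R
  = (a n.+1 / n.+1`!%:R) *: (n.+1%:R * (s - m) ^+ n)).
  exact: is_deriveZ.
rewrite factS natrM /= invfM [RHS]/(_ *: _) /=.
have n0 : (n.+1%:R : K) != 0 by rewrite pnatr_eq0.
have nf0 : (n`!%:R : K) != 0 by rewrite pnatr_eq0 -lt0n fact_gt0.
by rewrite /GRing.scale/=; field; rewrite nf0 addrC natr1 n0.
Qed.

(** Each derivative costs one application of the mean value theorem, which is
    why no factorial divides the constant.  The expansion point [m] is arbitrary
    in the interval; the middle of a step is the choice that makes the even and
    odd terms visible. *)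
Lemma taylor_le n (y : nat -> K -> K) (h m M : K) : 0 <= m <= h ->
  (forall k (t : K), (k < n)%N -> 0 < t < h -> is_derive t 1 (y k) (y k.+1 t)) ->
  (forall k, (k < n)%N -> {within `[0, h], continuous (y k)}) ->
  (forall t, 0 <= t <= h -> `|y n t| <= M) ->
  forall t, 0 <= t <= h ->
    `|y 0%N t - taylor (fun k => y k m) n (t - m)| <= M * `|t - m| ^+ n.
Proof.
move=> mh; elim: n y => [|n IH] y yd yc yM t th.
  by rewrite /taylor big_ord0 subr0 expr0 mulr1 yM.
have M0 : 0 <= M by rewrite (le_trans _ (yM _ mh)).
pose G s := y 0%N s - taylor (fun k => y k m) n.+1 (s - m).
pose dG s := y 1%N s - taylor (fun k => y k.+1 m) n (s - m).
have between (s : K) : Num.min m t <= s <= Num.max m t ->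
    0 <= s <= h /\ `|s - m| <= `|t - m|.
  case/andP: mh th => m0 mh /andP[t0 th].
  have [mt|tm] := leP m t => /andP[s1 s2].
    split; first by rewrite (le_trans m0 s1) (le_trans s2 th).
    by rewrite !ger0_norm ?subr_ge0 ?lerD2r.
  split; first by rewrite (le_trans t0 s1) (le_trans s2 mh).
  by rewrite !ler0_norm ?subr_le0 ?lerN2 ?lerD2r// ltW.
have Gm : G m = 0 by rewrite /G subrr taylor_at0 subrr.
have -> : y 0%N t - taylor (fun k => y k m) n.+1 (t - m) = G t - G m.
  by rewrite Gm subr0.
rewrite exprSr mulrA; apply: (derive_le_increment (df := dG)).
- move=> s /andP[s1 s2].
  apply: is_deriveB; last exact: is_derive_taylor.
  apply: yd => //; case/andP: mh => m0 mh; case/andP: th => t0 th.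
  by rewrite (le_lt_trans _ s1) ?le_min ?m0// (lt_le_trans s2)// ge_max mh.
- have Gc : {within `[0, h], continuous G}.
    move=> s; apply: (@continuousB K K (subspace `[0, h]) (y 0%N)
      (fun s => taylor (fun k => y k m) n.+1 (s - m))); first exact: yc.
    apply: continuous_subspaceT => r.
    apply/differentiable_continuous/derivable1_diffP.
    by have [] := is_derive_taylor (fun k => y k m) n m r.
  apply: continuous_subspaceW Gc => s /=; rewrite !in_itv /=.
  by move=> /between[].
move=> s /between[sh sm].
have := IH (fun k => y k.+1) _ _ yM s sh.
move=> /(_ (fun k r kn => yd k.+1 r kn))/(_ (fun k kn => yc k.+1 kn)).
move=> /le_trans; apply.
by rewrite ler_wpM2l// lerXn2r ?nnegrE.
Qed.

End Taylor.

(** * Estimates that are uniform over a step *)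

Section UniformStep.
Context {K : realType}.

(** The pairs (step size, parameter on the step): the step size tends to zero
    from above, uniformly in the parameter. *)
Definition small_step : set_system (K * K) :=
  [set P | \forall h \near 0^'+, forall s : K, 0 <= s <= 1 -> P (h, s)].

#[global] Instance small_step_filter : Filter small_step.
Proof.
split; first by apply: nearW.
  move=> P Q; rewrite /small_step /= => FP FQ.
  apply: (@filterS2 _ (0^'+) _ _ _ _ _ FP FQ) => h hP hQ s s01.
  by split; [exact: hP|exact: hQ].
move=> P Q PQ; rewrite /small_step /= => FP.
by apply: (@filterS _ (0^'+) _ _ _ _ FP) => h hP s s01; apply: PQ; exact: hP.
Qed.

Lemma small_stepE (P : K * K -> Prop) :
  (\forall h \near 0^'+, forall s : K, 0 <= s <= 1 -> P (h, s)) ->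
  \forall p \near small_step, P p.
Proof. by []. Qed.

Lemma near_small_step : \forall p \near small_step, 0 < p.1 /\ 0 <= p.2 <= 1.
Proof.
apply: small_stepE; near=> h => s s01; split=> //=.
Unshelve. all: by end_near. Qed.

Lemma near_small_step_ge0 n : \forall p \near small_step, 0 <= p.1 ^+ n.
Proof.
by apply: filterS near_small_step => p [p0 _]; rewrite exprn_ge0// ltW.
Qed.

Lemma dominated_small_step {V : normedModType K} (g : K -> K) (v : K * K -> V) :
  dominated small_step (fun p => g p.1) v ->
  exists C, \forall h \near 0^'+, forall s : K, 0 <= s <= 1 -> `|v (h, s)| <= C * g h.
Proof. by []. Qed.

Lemma dominated_slice {V : normedModType K} (g : K -> K) (v : K * K -> V) (s0 : K) :
  0 <= s0 <= 1 -> dominated small_step (fun p => g p.1) v ->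
  dominated small_step (fun p => g p.1) (fun p => v (p.1, s0)).
Proof.
move=> s01 [C vC]; exists C.
apply: small_stepE; apply: (@filterS _ (0^'+) _ _ _ _ vC) => h hC s _.
exact: (hC s0 s01).
Qed.

Lemma dominated_step {V : normedModType K} (g : K -> K) (v : K -> V) :
  dominated small_step (fun p => g p.1) (fun p => v p.1) -> dominated 0^'+ g v.
Proof.
move=> [C vC]; exists C; apply: (@filterS _ (0^'+) _ _ _ _ vC) => h hC.
by apply: (hC 0); rewrite lexx ler01.
Qed.

Lemma dominated_pow (n m : nat) {V : normedModType K} (v : K * K -> V) :
  (n <= m)%N -> dominated small_step (fun p => p.1 ^+ m) v ->
  dominated small_step (fun p => p.1 ^+ n) v.
Proof.
move=> nm; apply: dominated_le; apply: small_stepE; near=> h => s _ /=.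
have h0 : 0 < h by [].
have h1 : h <= 1 by near: h; exact: nbhs_right_le.
by rewrite exprn_ge0 ?(ltW h0)// ler_wiXn2l// ltW.
Unshelve. all: by end_near. Qed.

Lemma dominated_step_size n : dominated small_step (fun p => p.1 ^+ n) (fun p => p.1 ^+ n).
Proof. by apply: dominated_refl; exact: near_small_step_ge0. Qed.

Lemma dominated_parameter (v : K -> K) : continuous v ->
  dominated small_step (fun=> 1) (fun p => v p.2).
Proof.
move=> vc; have vc' : {within `[0, 1], continuous (fun s => `|v s|)}.
  apply: continuous_subspaceT => s; apply: (@continuous_comp _ _ _ v (fun z => `|z|)).
    exact: vc.
  exact: norm_continuous.
have [s0 _ s0P] := EVT_max ler01 vc'.
exists `|v s0|; apply: small_stepE; apply: nearW => h s s01.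
by rewrite mulr1; apply: s0P; rewrite in_itv.
Qed.

End UniformStep.

(** * Expansion along a solution *)

Section Flow.
Context {K : realType} {d : nat}.
Variables (X : set 'cV[K]_d) (V : 'I_d -> 'cV[K]_d -> K) (N : nat).
Variables (x0 : 'cV[K]_d) (T : K) (c : K -> 'cV[K]_d).
Hypotheses (oX : open X) (VC : forall i, classC N X (V i)) (T0 : 0 < T).
Hypotheses (c0 : c 0 = x0) (cX : forall t : K, 0 <= t < T -> X (c t)).
Hypothesis cc : {within `[0, T[, continuous c}.
Hypothesis cd : forall t : K, 0 < t < T -> is_derive t 1 c (\col_i V i (c t)).

Lemma classC_le m n (f : 'cV[K]_d -> K) : (m <= n)%N -> classC n X f -> classC m X f.
Proof.
move=> mn fC; rewrite -(subnK mn) in fC.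
by elim: (n - m)%N fC => // k IH /classCW.
Qed.

Lemma classC_iter_lie k n f : (n + k <= N.+1)%N -> classC (n + k) X f ->
  classC n X (iter k (lie V) f).
Proof.
elim: k n => [|k IH] n nk fC; first by rewrite addn0 in fC.
apply: classC_lie => // [i|]; last by apply: IH; rewrite addSnnS.
by apply: classC_le (VC i); rewrite -ltnS (leq_trans _ nk)// addnS ltnS leq_addr.
Qed.

Lemma flow_X0 : X x0.
Proof. by rewrite -c0; apply: cX; rewrite lexx. Qed.

Lemma flow_is_derive f (t : K) : classC 1 X f -> 0 < t < T ->
  is_derive t 1 (fun s => f (c s)) (lie V f (c t)).
Proof.
move=> f1 tT; have [t0 t1] := andP tT.
have ctX : X (c t) by apply: cX; rewrite ltW.
have E : lie V f (c t) = \sum_i partial i f (c t) * (\col_i V i (c t)) i 0.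
  by apply: eq_bigr => i _; rewrite mxE mulrC.
by rewrite E; apply: is_derive_comp oX f1 ctX (cd tT).
Qed.

Lemma flow_continuous n f (h : K) : classC n X f -> h < T ->
  {within `[0, h], continuous (fun s => f (c s))}.
Proof.
move=> fC hT; have sub : `[0, h] `<=` `[0, T[.
  by move=> s /=; rewrite !in_itv /= => /andP[-> sh]; exact: le_lt_trans sh hT.
apply: continuous_subspaceW sub _.
apply/subspace_continuousP => s sT.
have cs := (subspace_continuousP _ _).1 cc s sT.
apply: continuous_cvg cs.
by apply: classC_continuous fC _; apply: cX; move: sT; rewrite /= in_itv.
Qed.

Lemma near_step_lt : \forall h \near 0^'+, 0 < h < T.
Proof.
by near=> h; apply/andP; split.
Unshelve. all: by end_near. Qed.

Lemma flow_cvg : c (p.2 * p.1) @[p --> small_step] --> x0.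
Proof.
have := (subspace_continuousP _ _).1 cc 0.
rewrite /= in_itv /= lexx T0 => /(_ isT).
rewrite /from_subspace c0 => /cvgrPdist_le cc0.
apply/cvgrPdist_le => e e0; have := cc0 _ e0.
rewrite near_withinE => /nbhs_ballP[r /= r0 rP].
apply: small_stepE; near=> h => s /andP[s0 s1] /=.
have h0 : 0 < h by [].
have shh : s * h <= h by rewrite ler_piMl// ltW.
apply: rP.
  rewrite /ball /= sub0r normrN ger0_norm ?mulr_ge0// ?(ltW h0)//.
  by apply: le_lt_trans shh _; near: h; exact: nbhs_right_lt.
rewrite /= in_itv /= mulr_ge0// ?(ltW h0)//=.
by apply: le_lt_trans shh _; near: h; exact: nbhs_right_lt.
Unshelve. all: by end_near. Qed.

(** The time derivatives of [f] along the solution are its iterated Lie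
    derivatives; the last one is bounded near the initial point. *)
Lemma flow_taylor n f : (n <= N.+1)%N -> classC n X f ->
  dominated small_step (fun p => p.1 ^+ n) (fun p => f (c (p.2 * p.1))
    - taylor (fun k => iter k (lie V) f (c (p.1 / 2))) n ((p.2 - 2^-1) * p.1)).
Proof.
move=> nN fC.
have fnC : classC 0 X (iter n (lie V) f) by apply: classC_iter_lie.
have [C Cbound] :=
  @dominated_small_step K K (fun=> 1) _ (dominated_classC flow_X0 flow_cvg fnC).
exists `|C|; apply: small_stepE; near=> h => s /andP[s0 s1] /=.
have /andP[h0 hT] : 0 < h < T by near: h; exact: near_step_lt.
have Ch : forall s : K, 0 <= s <= 1 -> `|iter n (lie V) f (c (s * h))| <= C * 1.
  by near: h.
have mh : 0 <= h / 2 <= h.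
  by rewrite divr_ge0 ?(ltW h0)//= ler_pdivrMr// ler_peMr ?(ltW h0)// ler1n.
have thh : 0 <= s * h <= h by rewrite mulr_ge0 ?(ltW h0)//= ler_piMl// ltW.
have := @taylor_le K n (fun k t => iter k (lie V) f (c t)) h (h / 2) `|C| mh.
move=> /(_ _ _ _ (s * h) thh).
rewrite (_ : s * h - h / 2 = (s - 2^-1) * h); last by rewrite mulrBl mulrC [h / 2]mulrC.
move=> /(_ _ _ _)/le_trans; apply.
- move=> k t kn /andP[t0 th]; rewrite /=; apply: flow_is_derive.
    apply: classC_iter_lie; first by rewrite add1n; exact: leq_trans kn nN.
    by apply: classC_le fC; rewrite add1n.
  by rewrite t0 (lt_trans th).
- move=> k kn; apply: (@flow_continuous 0) => //.
  apply: classC_iter_lie; first by rewrite add0n (leq_trans (ltnW kn)).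
  by apply: classC_le fC; rewrite add0n ltnW.
- move=> t /andP[t0 th].
  have th1 : 0 <= t / h <= 1 by rewrite divr_ge0 ?(ltW h0)//= ler_pdivrMr// mul1r.
  have := Ch _ th1; rewrite divfK ?gt_eqF// mulr1 => /le_trans; apply.
  exact: ler_norm.
rewrite ler_wpM2l// normrM exprMn_comm; last exact: mulrC.
rewrite (ger0_norm (ltW h0)) ler_piMl ?exprn_ge0 ?(ltW h0)// exprn_ile1//.
by rewrite ler_norml; apply/andP; split; lra.
Unshelve. all: by end_near. Qed.

Lemma flow_mid_cvg : c (p.1 / 2) @[p --> small_step] --> x0.
Proof.
apply/cvgrPdist_le => e e0.
have /cvgrPdist_le/(_ e e0) := flow_cvg; move=> cE.
apply: small_stepE; apply: (@filterS _ (0^'+) _ _ _ _ cE) => h hE s _ /=.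
by have := hE 2^-1; rewrite /= mulrC; apply; rewrite invr_ge0 invf_le1// ler0n ler1n.
Qed.

Lemma flow_end_cvg : c p.1 @[p --> small_step] --> x0.
Proof.
apply/cvgrPdist_le => e e0.
have /cvgrPdist_le/(_ e e0) := flow_cvg; move=> cE.
apply: small_stepE; apply: (@filterS _ (0^'+) _ _ _ _ cE) => h hE s _ /=.
by have := hE 1; rewrite /= mul1r; apply; rewrite ler01 lexx.
Qed.

End Flow.

(** * Defect of the exact solution *)

Section SmallStepOrders.
Context {K : realType}.

Local Notation small n v := (dominated small_step (fun p => p.1 ^+ n) v).

Lemma bounded_small {V : normedModType K} (v : K * K -> V) :
  dominated small_step (fun=> 1) v -> small 0 v.
Proof. by apply: dominated_bound_eq; apply: nearW => p; rewrite expr0. Qed.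

Lemma smallM n m (k v : K * K -> K) :
  small n k -> small m v -> small (n + m) (fun p => k p * v p).
Proof.
move=> ks vs; apply: dominated_bound_eq (dominatedM ks vs).
by apply: nearW => p; rewrite exprD.
Qed.

Lemma small_parameter (v : K -> K) : continuous v -> small 0 (fun p => v p.2).
Proof. by move=> vc; apply: bounded_small; exact: dominated_parameter. Qed.

Lemma small_cst {V : normedModType K} (a : V) : small 0 (fun=> a).
Proof. by apply: bounded_small; exact: dominated_cst. Qed.

End SmallStepOrders.

Section ChordDefect.
Context {K : realType} {d : nat}.
Variables (X : set 'cV[K]_d) (H : 'cV[K]_d -> K) (B : 'M[K]_d).
Variables (x0 : 'cV[K]_d) (T : K) (c : K -> 'cV[K]_d).

Definition flow_field (i : 'I_d) (x : 'cV[K]_d) : K := (B *m grad H x) i 0.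

Hypotheses (oX : open X) (HC : classC 4 X H) (T_gt0 : 0 < T).
Hypotheses (c0 : c 0 = x0) (cX : forall t : K, 0 <= t < T -> X (c t)).
Hypothesis cc : {within `[0, T[, continuous c}.
Hypothesis cd : forall t : K, 0 < t < T -> is_derive t 1 c (\col_i flow_field i (c t)).

Local Notation small n v := (dominated small_step (fun p => p.1 ^+ n) v).

(* The two weights of the expansion around the middle of the step: [w], which is
   even there and equal to [u ^+ 2 - 1 / 4], and [u * w], which is odd. *)
Let w (s : K) : K := s ^+ 2 - s.
Let u (s : K) : K := s - 2^-1.
(* A pair [p] stands for a step of size [p.1] and for the fraction [p.2] of it. *)
Let cs (p : K * K) := c (p.2 * p.1).
Let cm (p : K * K) := c (p.1 / 2).
Let ch (p : K * K) := chord x0 (c p.1) p.2.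
Let Y k (j : 'I_d) p := iter k (lie flow_field) (fun y => y j 0) (cm p).
Let S i j := partial j (partial i H).

Lemma flow_fieldE i x : flow_field i x = \sum_l B i l * partial l H x.
Proof. by rewrite /flow_field mxE; apply: eq_bigr => l _; rewrite mxE. Qed.

Lemma classC_flow_field i : classC 3 X (flow_field i).
Proof.
have -> : flow_field i = fun x => \sum_l B i l * partial l H x.
  by apply/funext => x; exact: flow_fieldE.
apply: classC_sum => // l; apply: classCM => //; first exact: classC_cst.
exact: classC_partial.
Qed.

Let x0X : X x0. Proof. exact: flow_X0 T_gt0 c0 cX. Qed.
Let cs_cvg : cs p @[p --> small_step] --> x0.
Proof. exact: flow_cvg T_gt0 c0 cc. Qed.
Let cm_cvg : cm p @[p --> small_step] --> x0.
Proof. exact: flow_mid_cvg T_gt0 c0 cc. Qed.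
Let ch_cvg : ch p @[p --> small_step] --> x0.
Proof.
have ec := flow_end_cvg T_gt0 c0 cc.
apply/cvgrPdist_le => e e0.
have /cvgrPdist_le/(_ e e0) := ec.
apply: filterS2 near_small_step => p [_ p01]; rewrite distrC [X in _ -> X <= _]distrC.
by apply: chord_dist_le => //; rewrite subrr normr0 ltW.
Qed.

Let w_bounded : small 0 (fun p => w p.2).
Proof.
apply: small_parameter => s.
apply: (@continuousB K K K (fun s => s ^+ 2) id); last exact: cvg_id.
by apply/differentiable_continuous/derivable1_diffP; exact: exprn_derivable.
Qed.
Let u_bounded : small 0 (fun p => u p.2).
Proof.
apply: small_parameter => s.
by apply: (@continuousB K K K id (fun=> 2^-1)); [exact: cvg_id|exact: cvg_cst].
Qed.

Let Y_bounded k j : (k <= 4)%N -> small 0 (Y k j).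
Proof.
move=> k4; apply: bounded_small.
have YC : classC 0 X (iter k (lie flow_field) (fun y => y j 0)).
  apply: (classC_iter_lie (n := 0) oX classC_flow_field); first by rewrite add0n.
  exact: classC_coord.
exact: (dominated_classC x0X cm_cvg YC).
Qed.

Let small_h n : small n (fun p : K * K => p.1 ^+ n).
Proof. exact: dominated_step_size. Qed.

(** The chord interpolates the solution at both ends of the step, and this
    reproduces affine functions: the constant and linear terms of the expansion
    around the middle cancel.  The quadratic and the cubic terms leave the
    weights [w] and [u * w], which vanish at both ends. *)
Lemma chord_gap j : small 4 (fun p : K * K => ch p j 0 - cs p j 0
  + p.1 ^+ 2 / 2 * w p.2 * Y 2 j p + p.1 ^+ 3 / 6 * (u p.2 * w p.2) * Y 3 j p).
Proof.
have Etay := flow_taylor oX classC_flow_field T_gt0 c0 cX cc cd (leqnn 4)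
  (classC_coord 4 X j).
set E := (X in dominated _ _ X) in Etay.
have i0 : 0 <= (0 : K) <= 1 by rewrite lexx ler01.
have i1 : 0 <= (1 : K) <= 1 by rewrite lexx ler01.
have E0 := @dominated_slice K K (fun h => h ^+ 4) E 0 i0 Etay.
have E1 := @dominated_slice K K (fun h => h ^+ 4) E 1 i1 Etay.
have s0 : small 0 (fun p : K * K => 1 - p.2).
  apply: (small_parameter (v := fun s => 1 - s)) => s.
  by apply: (@continuousB K K K (fun=> 1) id); [exact: cvg_cst|exact: cvg_id].
have s1 : small 0 (fun p : K * K => p.2).
  by apply: (small_parameter (v := id)) => s; exact: cvg_id.
apply: dominated_near (dominatedB (dominatedD (smallM s0 E0) (smallM s1 E1)) Etay).
apply: nearW => -[h s] /=; rewrite /E /= mul0r mul1r c0 !taylorS /taylor !big_ord0.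
rewrite /ch /cs /Y /w /u /cm /chord !mxE /=.
rewrite (_ : 0`! = 1%N)// (_ : 1`! = 1%N)// (_ : 2`! = 2%N)// (_ : 3`! = 6%N)//.
move: (lie _ (lie _ (lie _ _)) _) (lie _ (lie _ _) _) (lie _ _ _) => y3 y2 y1.
move: (c (h / 2) j 0) (c (s * h) j 0) (c h j 0) (x0 j 0) => y0 a b e.
by field.
Qed.

Let hwY_small k j : (k <= 4)%N ->
  small 2 (fun p => p.1 ^+ 2 / 2 * w p.2 * Y k j p).
Proof.
move=> k4; apply: (smallM (n := 2) (m := 0)); last exact: Y_bounded.
apply: (smallM (n := 2) (m := 0)); last exact: w_bounded.
exact: (smallM (n := 2) (m := 0) (small_h 2) (small_cst _)).
Qed.

Let huwY_small k j : (k <= 4)%N ->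
  small 3 (fun p => p.1 ^+ 3 / 6 * (u p.2 * w p.2) * Y k j p).
Proof.
move=> k4; apply: (smallM (n := 3) (m := 0)); last exact: Y_bounded.
apply: (smallM (n := 3) (m := 0)); last exact: (smallM u_bounded w_bounded).
exact: (smallM (n := 3) (m := 0) (small_h 3) (small_cst _)).
Qed.

Lemma chord_gap_small : small 2 (fun p => ch p - cs p).
Proof.
apply: dominated_mx => [|j k]; first exact: near_small_step_ge0.
have gap := dominated_pow (n := 2) (m := 4) isT (chord_gap j).
have c3 := dominated_pow (n := 2) (m := 3) isT (huwY_small j (k := 3) isT).
apply: dominated_near (dominatedB (dominatedB gap c3) (hwY_small j (k := 2) isT)).
have coordB (a b : 'cV[K]_d) : (a - b) j 0 = a j 0 - b j 0 by rewrite !mxE.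
by apply: nearW => p; rewrite ord1 coordB !addrK.
Qed.

Let classC_S i j : classC 2 X (S i j).
Proof. exact: classC_partial (classC_partial i HC). Qed.

Let S1_bounded i j : small 0 (fun p => lie flow_field (S i j) (cm p)).
Proof.
apply: bounded_small; apply: (dominated_classC (n := 1) x0X cm_cvg).
apply: classC_lie => // k.
exact: (classC_le (n := 3) _ (classC_flow_field k)).
Qed.

(* The coefficients of the weights [w] and [u * w] in the gap between the
   gradient along the chord and along the solution; both only depend on the
   middle of the step. *)
Let even_coef i p := \sum_j S i j (cm p) * Y 2 j p.
Let odd_coef i p :=
  \sum_j (lie flow_field (S i j) (cm p) * Y 2 j p / 2 + S i j (cm p) * Y 3 j p / 6).

(** The Hessian along the solution varies by [h * u] times its derivative at the
    middle; multiplied with the even term of the chord gap this produces another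
    odd term. *)
Lemma hess_gap i j : small 4 (fun p => S i j (cs p) * (ch p j 0 - cs p j 0)
  + (p.1 ^+ 2 / 2 * w p.2 * (S i j (cm p) * Y 2 j p) + p.1 ^+ 3 * (u p.2 * w p.2)
   * (lie flow_field (S i j) (cm p) * Y 2 j p / 2 + S i j (cm p) * Y 3 j p / 6))).
Proof.
have Stay := flow_taylor oX classC_flow_field T_gt0 c0 cX cc cd (n := 2) isT
  (classC_S i j).
have Scs : small 0 (fun p => S i j (cs p)).
  by apply: bounded_small; apply: (dominated_classC x0X cs_cvg (classC_S i j)).
have main : small 2 (fun p => p.1 ^+ 2 / 2 * w p.2 * Y 2 j p
    + p.1 ^+ 3 / 6 * (u p.2 * w p.2) * Y 3 j p).
  apply: dominatedD; first exact: hwY_small.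
  by apply: (dominated_pow (m := 3)) => //; exact: huwY_small.
have last : small 4 (fun p => p.1 ^+ 4 * ((u p.2 * (u p.2 * w p.2))
    * (lie flow_field (S i j) (cm p) * (Y 3 j p * 6^-1)))).
  apply: (smallM (n := 4) (m := 0)); first exact: small_h.
  apply: (smallM (n := 0) (m := 0)).
    exact: (smallM u_bounded (smallM u_bounded w_bounded)).
  apply: (smallM (n := 0) (m := 0)); first exact: S1_bounded.
  by apply: (smallM (n := 0) (m := 0)); [exact: Y_bounded|exact: small_cst].
apply: dominated_near (dominatedB (dominatedB
  (smallM (n := 0) (m := 4) Scs (chord_gap j)) (smallM (n := 2) (m := 2) Stay main)) last).
apply: nearW => p; rewrite !taylorS /taylor big_ord0 /=.
rewrite (_ : 0`! = 1%N)// (_ : 1`! = 1%N)// -/(cs p) -/(cm p) -/(u p.2).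
move: (lie flow_field (S i j) (cm p)) (S i j (cm p)) (S i j (cs p)) => g1 g0 g.
move: (Y 2 j p) (Y 3 j p) (w p.2) (u p.2) (ch p j 0) (cs p j 0) => b b' e f k l.
by field.
Qed.

(** First order Taylor expansion around the solution: the square of the chord gap
    is of order four. *)
Lemma grad_gap i : small 4 (fun p => partial i H (ch p) - partial i H (cs p)
  + (p.1 ^+ 2 / 2 * w p.2 * even_coef i p
     + p.1 ^+ 3 * (u p.2 * w p.2) * odd_coef i p)).
Proof.
have iC : classC 2 X (partial i H).
  exact: classCW (classC_partial i HC).
have tay : small 4 (fun p => partial i H (ch p) - partial i H (cs p)
    - \sum_j S i j (cs p) * (ch p j 0 - cs p j 0)).
  apply: dominated_bound_eq (dominated_taylor oX x0X cs_cvg ch_cvg iC chord_gap_small).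
  by apply: nearW => p; rewrite -exprM.
apply: dominated_near (dominatedD tay (dominated_sum (index_enum _) (hess_gap i))).
apply: nearW => p; rewrite big_split/= big_split/= -!mulr_sumr.
by rewrite /even_coef /odd_coef; ring.
Qed.

Let even_field k p := \sum_i B k i * even_coef i p.
Let odd_field k p := \sum_i B k i * odd_coef i p.

Lemma field_gap k : small 4 (fun p => \sum_i B k i * partial i H (ch p)
  - (flow_field k (cs p) - p.1 ^+ 2 / 2 * w p.2 * even_field k p
     - p.1 ^+ 3 * (u p.2 * w p.2) * odd_field k p)).
Proof.
apply: dominated_near (dominated_sum (index_enum _)
  (fun i => smallM (n := 0) (m := 4) (small_cst (B k i)) (grad_gap i))).
apply: nearW => p.
under eq_bigr do rewrite mulrDr mulrBr mulrDr !(mulrCA (B k _)).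
rewrite !big_split/= sumrN -!mulr_sumr flow_fieldE /even_field /odd_field.
by ring.
Qed.

Let is_derive_monomial (a : K) n (s : K) :
  is_derive s 1 (fun s => a * s ^+ n.+1) (a * (n.+1%:R * s ^+ n)).
Proof.
apply: (@is_deriveZ _ _ _ (fun s : K => s ^+ n.+1) a).
have E := @is_deriveX K K id n.+1 s 1 1 (is_derive_id _ _).
rewrite [X in is_derive _ _ _ X]mulr1 in E.
rewrite (_ : (fun s => s ^+ n.+1) = id ^+ n.+1); first exact: E.
by apply/funext => r; rewrite exprfctE.
Qed.

Let lie_coord k : lie flow_field (fun y => y k 0) = flow_field k.
Proof.
apply/funext => y; rewrite /lie (bigD1 k)//= big1 ?addr0 => [|i ik].
  by have [_ E] := derivable_coord y k k; rewrite /partial E eqxx mulr1.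
by have [_ E] := derivable_coord y i k; rewrite /partial E (negbTE ik) mulr0.
Qed.

Let rescaled_continuous (h : K) k : 0 < h -> h < T ->
  {within `[0, 1], continuous (fun s => c (s * h) k 0)}.
Proof.
move=> h0 hT; apply/subspace_continuousP => s; rewrite /= in_itv /= => s01.
have shh (r : K) : 0 <= r <= 1 -> 0 <= r * h <= h.
  by move=> /andP[r0 r1]; rewrite mulr_ge0 ?(ltW h0)//= ler_piMl// ltW.
have := (subspace_continuousP _ _).1
  (flow_continuous cX cc (classC_coord 0 X k) hT) (s * h).
rewrite /= in_itv /= => /(_ (shh _ s01)) /cvgrPdist_le ccs.
apply/cvgrPdist_le => e e0; have := ccs _ e0; rewrite !near_withinE => near_sh.
have sc : r * h @[r --> s] --> s * h by apply: cvgMr_tmp; exact: cvg_id.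
apply: (@filterS _ (nbhs s) _ _ _ _ (sc _ near_sh)) => r /= rP.
by rewrite !in_itv /= => /shh rh; apply: rP; rewrite in_itv.
Qed.

(** The field along the solution averages to the slope of the chord, the even
    weight [w] has mean [- 1 / 6], and the odd weight [u * w], the derivative of
    [w ^+ 2 / 4], has mean zero. *)
Lemma avf_defect k : dominated 0^'+ (fun h => h ^+ 4)
  (fun h => \sum_i B k i * avf H x0 (c h) i 0 - (c h k 0 - x0 k 0) / h
     - h ^+ 2 / 12 * even_field k (h, 0)).
Proof.
have [C Cgap] := @dominated_small_step K K (fun h => h ^+ 4) _ (field_gap k).
have ec : c h @[h --> 0^'+] --> x0.
  have := flow_end_cvg T_gt0 c0 cc; move=> ec A /ec eA.
  by apply: (@filterS _ (0^'+) _ _ _ _ eA) => h /(_ 0); rewrite lexx ler01; exact.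
have adm : \forall h \near 0^'+, admissible X x0 (c h).
  by apply: (near_admissible oX x0X _ ec); exact: cvg_cst.
exists C.
apply: (@filterS3 _ (0^'+) _ _ _ _ _ _ Cgap (near_step_lt T_gt0) adm).
move=> h hC /andP[h0 hT] {}adm.
have h_neq0 : h != 0 by rewrite gt_eqF.
pose be := even_field k (h, 0); pose ga := odd_field k (h, 0).
(* Coefficients of the antiderivative [- (h ^+ 2 / 2) * be * (s ^+ 3 / 3 - s ^+ 2 / 2)
   - h ^+ 3 * ga * w s ^+ 2 / 4] of the weighted terms. *)
pose a2 := h ^+ 2 * be / 4 - h ^+ 3 * ga / 4.
pose a3 := - (h ^+ 2 * be / 6) + h ^+ 3 * ga / 2.
pose a4 := - (h ^+ 3 * ga / 4).
pose q s := h^-1 * c (s * h) k 0 + a2 * s ^+ 2 + a3 * s ^+ 3 + a4 * s ^+ 4.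
pose dq s := flow_field k (c (s * h)) - h ^+ 2 / 2 * w s * be
  - h ^+ 3 * (u s * w s) * ga.
have H1 : classC 1 X H by do 3!apply: classCW.
have -> : \sum_i B k i * avf H x0 (c h) i 0 - (c h k 0 - x0 k 0) / h
    - h ^+ 2 / 12 * even_field k (h, 0)
    = \sum_i B k i * avf H x0 (c h) i 0 - (q 1 - q 0).
  rewrite /q mul0r mul1r c0 -/be /a2 /a3 /a4.
  by move: (\sum_i _) (c h k 0) (x0 k 0) => a b e; field.
apply: (avf_approx (dq := dq) H1 adm).
- move=> s /andP[s0 s1].
  have sh : 0 < s * h < T.
    by rewrite mulr_gt0//= (lt_trans _ hT)// -[ltRHS]mul1r ltr_pM2r.
  have cd1 : is_derive s 1 (fun s => c (s * h) k 0) (flow_field k (c (s * h)) * h).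
    have hd : is_derive s 1 (fun s : K => s * h) h.
      have := is_derive_monomial h 0 s; rewrite expr0 !mulr1.
      by under eq_fun do rewrite expr1 mulrC.
    have := flow_is_derive oX cX cd (classC_coord 1 X k) sh; rewrite lie_coord.
    move=> cks; exact (@is_derive1_comp K (fun t => c t k 0) (fun s => s * h)
      s _ _ cks hd).
  have hcd : is_derive s 1 (fun s => h^-1 * c (s * h) k 0) (flow_field k (c (s * h))).
    have E := @is_deriveZ K K K (fun s => c (s * h) k 0) h^-1 s 1 _ cd1.
    by apply: is_derive_eq E _; rewrite /GRing.scale/= mulrC mulfK.
  have qd := is_deriveD (is_deriveD (is_deriveD hcd (is_derive_monomial a2 1 s))
    (is_derive_monomial a3 2 s)) (is_derive_monomial a4 3 s).
  apply: is_derive_eq qd _.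
  rewrite /dq /a2 /a3 /a4 /w /u.
  by move: (flow_field _ _) => f; field.
- have poly_continuous (a : K) n : continuous (fun s : K => a * s ^+ n.+1).
    move=> s; apply/differentiable_continuous/derivable1_diffP.
    by have [] := is_derive_monomial a n s.
  have hc : {within `[0, 1], continuous (fun s => h^-1 * c (s * h) k 0)}.
    by move=> s; apply: cvgMl_tmp; exact: rescaled_continuous.
  have pc (a : K) n := @continuous_subspaceT K K `[0, 1] _ (poly_continuous a n).
  move=> s; apply: cvgD; last exact: pc.
  by apply: cvgD; last exact: pc; apply: cvgD; [exact: hc|exact: pc].
by move=> s s01; exact: hC.
Qed.

Let partial_flow_field i j x : X x -> partial i (flow_field j) x = (B *m hess H x) j i.
Proof.
move=> Xx; have -> : flow_field j = \sum_l (fun x => B j l * partial l H x).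
  by apply/funext => y; rewrite flow_fieldE fct_sumE.
have HlD l : derivable (fun x => B j l * partial l H x) x (delta_mx i 0).
  apply: derivableM; first exact: derivable_cst.
  exact: classC_derivable (classC_partial l HC) Xx.
rewrite /partial derive_sum// mxE; apply: eq_bigr => l _.
rewrite mxE deriveM; [|exact: derivable_cst|];
  last exact: classC_derivable (classC_partial l HC) Xx.
by rewrite derive_cst scaler0 addr0.
Qed.

Let second_lie_coord j x : X x ->
  lie flow_field (lie flow_field (fun y => y j 0)) x
  = (B *m hess H x *m (B *m grad H x)) j 0.
Proof.
move=> Xx; rewrite lie_coord /lie [RHS]mxE; apply: eq_bigr => i _.
by rewrite partial_flow_field// mulrC.
Qed.

(** The second derivative of the solution is [B *m S] applied to its first
    derivative [B *m grad H], which turns the even term into a word. *)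
Lemma avf_defect_mx : dominated 0^'+ (fun h => h ^+ 4) (fun h =>
  B *m avf H x0 (c h) - h^-1 *: (c h - x0)
  - (h ^+ 2 / 12) *: (B *m hess H (c (h / 2)) *m
      (B *m hess H (c (h / 2)) *m (B *m grad H (c (h / 2)))))).
Proof.
apply: dominated_mx => [|k l].
  by near=> h; apply: exprn_ge0.
rewrite ord1; have near_cm : \forall h \near 0^'+, X (c (h / 2)).
  apply: filterS (near_step_lt T_gt0) => h /andP[h0 hT]; apply: cX.
  rewrite divr_ge0 ?(ltW h0)//= (le_lt_trans _ hT)// ler_pdivrMr// ler_peMr ?ler1n//.
  exact: ltW.
apply: dominated_near (avf_defect k); apply: filterS near_cm => h Xm.
have -> : even_field k (h, 0) = (B *m hess H (c (h / 2)) *m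
      (B *m hess H (c (h / 2)) *m (B *m grad H (c (h / 2))))) k 0.
  rewrite -[_ *m _ *m (_ *m _)]mulmxA mxE; apply: eq_bigr => i _; congr (_ * _).
  rewrite mxE; apply: eq_bigr => j _; rewrite mxE; congr (_ * _).
  exact: second_lie_coord.
move: (B *m hess H _ *m _) => Q; rewrite !mxE.
by congr (_ - _ - _); rewrite mulrC.
Unshelve. all: by end_near. Qed.

(** Expanding around the middle of the step gains one order: the even terms at
    its two ends cancel. *)
Lemma chord_slope : dominated 0^'+ (fun h => h ^+ 2) (fun h =>
  h^-1 *: (c h - x0) - B *m grad H (c (h / 2))).
Proof.
apply: dominated_mx => [|k l].
  by near=> h; apply: exprn_ge0.
rewrite ord1.
have Etay := flow_taylor oX classC_flow_field T_gt0 c0 cX cc cd (n := 3) isT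
  (classC_coord 3 X k).
set E := (X in dominated _ _ X) in Etay.
have i0 : 0 <= (0 : K) <= 1 by rewrite lexx ler01.
have i1 : 0 <= (1 : K) <= 1 by rewrite lexx ler01.
have E0 := @dominated_slice K K (fun h => h ^+ 3) E 0 i0 Etay.
have E1 := @dominated_slice K K (fun h => h ^+ 3) E 1 i1 Etay.
have [C EC] := @dominated_step K K (fun h => h ^+ 3) (fun h => E (h, 1) - E (h, 0))
  (dominatedB E1 E0).
exists C; apply: filterS2 EC (near_step_lt T_gt0) => h hC /andP[h0 hT].
have h_neq0 : h != 0 by rewrite gt_eqF.
have EE : E (h, 1) - E (h, 0) = h * (h^-1 *: (c h - x0) - B *m grad H (c (h / 2))) k 0.
  rewrite /E /= mul1r mul0r c0 !taylorS /taylor !big_ord0.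
  rewrite (_ : 0`! = 1%N)// (_ : 1`! = 1%N)// (_ : 2`! = 2%N)//= lie_coord /flow_field.
  move: (lie _ _ _) (B *m grad H _) (c (h / 2) k 0) => y2 b y0; rewrite !mxE.
  by move: (c h k 0) (x0 k 0) (b k 0) => y a b'; field.
move: hC; rewrite EE normrM (gtr0_norm h0) -ler_pdivlMl// => /le_trans; apply.
by rewrite mulrCA exprS mulKf.
Unshelve. all: by end_near. Qed.

Lemma midpoint_gap : dominated 0^'+ (fun h => h ^+ 2) (fun h =>
  midpoint x0 (c h) - c (h / 2)).
Proof.
have ih : 0 <= (2^-1 : K) <= 1 by rewrite invr_ge0 invf_le1// ler0n ler1n.
have gap := @dominated_slice K _ (fun h => h ^+ 2) _ _ ih chord_gap_small.
have := @dominated_step K _ (fun h => h ^+ 2) (fun h => ch (h, 2^-1) - cs (h, 2^-1)) gap.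
apply: dominated_near; apply: nearW => h; rewrite /ch /cs /= [2^-1 * h]mulrC.
congr (_ - _); rewrite /chord /midpoint; apply/colP => i; rewrite !mxE.
by field.
Qed.

End ChordDefect.

(** * Dependence of the scheme on its end point *)

Section AvfDependence.
Context {K : realType} {d : nat}.
Variables (X : set 'cV[K]_d) (H : 'cV[K]_d -> K) (x : 'cV[K]_d).
Hypotheses (oX : open X) (HC : classC 2 X H) (Xx : X x).
Context {T : Type} (F : set_system T) {FF : Filter F}.
Variables (y z : T -> 'cV[K]_d) (g : T -> K).
Hypotheses (yx : y @ F --> x) (zx : z @ F --> x).

Lemma dominated_avf : (\forall t \near F, 0 <= g t) ->
  dominated F g (fun t => y t - z t) ->
  dominated F g (fun t => avf H x (y t) - avf H x (z t)).
Proof.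
move=> g0 [C Cyz]; apply: dominated_mx => // i k; rewrite ord1.
have iC := classC_partial i HC.
have [L [r r0 rP]] := local_lipschitz oX iC Xx.
have H1 : classC 1 X H := classCW HC.
have cx : (fun=> x) @ F --> x by exact: cvg_cst.
exists (`|L| * C); near=> t.
have xy : admissible X x (y t).
  by near: t; exact: (near_admissible oX Xx cx yx).
have xz : admissible X x (z t).
  by near: t; exact: (near_admissible oX Xx cx zx).
have yr : `|y t - x| <= r by near: t; exact: (near_norm_sub_le yx).
have zr : `|z t - x| <= r by near: t; exact: (near_norm_sub_le zx).
have yzC : `|y t - z t| <= C * g t by near: t.
have [U [Ud Uc UE]] := avf_antiderivative i H1 xz.
have := @avf_approx K d X H x (y t) (fun l => (l == i)%:R) U
  (fun s => partial i H (chord x (z t) s)) (`|L| * C * g t) H1 xy Ud Uc.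
have pick (f : 'I_d -> K) : \sum_l (l == i)%:R * f l = f i.
  rewrite (bigD1 i)//= eqxx mul1r big1 ?addr0// => l /negbTE ->.
  by rewrite mul0r.
have coordB (a b : 'cV[K]_d) : (a - b) i 0 = a i 0 - b i 0 by rewrite !mxE.
rewrite pick -UE -coordB; apply => s s01; rewrite pick.
have xr : `|x - x| <= r by rewrite subrr normr0 ltW.
rewrite (le_trans (rP _ _ (chord_dist_le s01 xr zr) (chord_dist_le s01 xr yr)))//.
have -> : chord x (y t) s - chord x (z t) s = s *: (y t - z t).
  by rewrite /chord opprD addrACA subrr add0r scalerBr.
rewrite (le_trans (ler_wpM2r _ (ler_norm _)))// -mulrA ler_wpM2l//.
case/andP: s01 => s0 s1; rewrite normrZ ger0_norm//.
by rewrite (le_trans _ yzC)// ler_piMl.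
Unshelve. all: by end_near. Qed.

End AvfDependence.

Lemma mulmx_difference {K : realType} {d : nat} (B P Q : 'M[K]_d)
    (a b : 'cV[K]_d) (k : K) :
  B *m (a - b) - k *: ((P - Q) *m a + Q *m (a - b))
  = B *m a - k *: (P *m a) - (B *m b - k *: (Q *m b)).
Proof.
rewrite mulmxBl !mulmxBr subrKA.
move: (B *m a) (B *m b) (P *m a) (Q *m b) => e f g i.
by apply/matrixP => l j; rewrite !mxE; ring.
Qed.

Lemma mulmx_defect {K : realType} {d : nat} (A B S : 'M[K]_d)
    (a b e : 'cV[K]_d) (k : K) :
  B *m a - e - k *: (B *m S *m (B *m S *m (B *m b)))
    - k *: ((A - B *m S *m B *m S *m B) *m a
            + B *m S *m (B *m S) *m (B *m a - B *m b))
  = B *m a - k *: (A *m a) - e.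
Proof.
rewrite mulmxBl mulmxBr !mulmxA subrKA.
move: (B *m a) (A *m a) (_ *m b) => f g i.
by apply/matrixP => l j; rewrite !mxE; ring.
Qed.

Section OrderFour.
Context {K : realType} {d : nat}.
Variables (X : set 'cV[K]_d) (H : 'cV[K]_d -> K) (B : 'M[K]_d).
Variables (x0 : 'cV[K]_d).
Hypotheses (oX : open X) (HC : classC 4 X H) (Xx0 : X x0).

Let W (S : 'M[K]_d) : 'M[K]_d := B *m S *m B *m S *m B.

(** The increment of the method per unit of step size, without the remainder of
    order four. *)
Definition corrected_increment (h : K) (y : 'cV[K]_d) : 'cV[K]_d :=
  (B - (h ^+ 2 / 12) *: (B *m hess H (midpoint x0 y) *m B
     *m hess H (midpoint x0 y) *m B)) *m avf H x0 y.

Lemma corrected_incrementE h y : corrected_increment h y =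
  B *m avf H x0 y - (h ^+ 2 / 12) *: (W (hess H (midpoint x0 y)) *m avf H x0 y).
Proof. by rewrite /corrected_increment mulmxBl -scalemxAl. Qed.

(** Change one factor [S] at a time. *)
Lemma dominated_words (T : Type) (F : set_system T) {FF : Filter F} (g : T -> K)
    (S S' : T -> 'M[K]_d) :
  dominated F (fun=> 1) S -> dominated F (fun=> 1) S' ->
  dominated F g (fun t => S t - S' t) ->
  dominated F g (fun t => W (S t) - W (S' t)).
Proof.
move=> S1 S'1 SS'.
have B1 : dominated F (fun=> 1) (fun=> B) by exact: dominated_cst.
have E t : B *m (S t - S' t) *m B *m S t *m B + B *m S' t *m B *m (S t - S' t) *m B
    = W (S t) - W (S' t).
  rewrite /W !(mulmxBr, mulmxBl).
  by rewrite addrA subrK.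
apply: dominated_near; first by apply: nearW => t; exact: E.
apply: dominatedD.
  do 3?[apply: mulmx_bounded => //]; exact: bounded_mulmx.
apply: mulmx_bounded => //; do 3?[apply: bounded_mulmx => //].
Qed.

Lemma dominated_words_bounded (T : Type) (F : set_system T) {FF : Filter F}
    (S : T -> 'M[K]_d) : dominated F (fun=> 1) S -> dominated F (fun=> 1) (W \o S).
Proof.
move=> S1; have B1 : dominated F (fun=> 1) (fun=> B) by exact: dominated_cst.
by rewrite /W; do 4?[apply: bounded_mulmx => //].
Qed.

Lemma near_step_pow n : \forall h \near (0 : K)^'+, 0 <= h ^+ n.
Proof. by near=> h; apply: exprn_ge0. Unshelve. all: by end_near. Qed.

Lemma dominated_step_coef : dominated (0 : K)^'+ (fun h => h ^+ 2) (fun h => h ^+ 2 / 12).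
Proof.
exists 12^-1; apply: nearW => h.
by rewrite normrM ger0_norm ?sqr_ge0// ger0_norm ?invr_ge0// mulrC.
Qed.

Lemma hess_lipschitz (T : Type) (F : set_system T) {FF : Filter F} (g : T -> K)
    (y z : T -> 'cV[K]_d) : y @ F --> x0 -> z @ F --> x0 ->
  (\forall t \near F, 0 <= g t) ->
  dominated F g (fun t => y t - z t) ->
  dominated F g (fun t => hess H (y t) - hess H (z t)).
Proof.
move=> yx zx g0 yz; apply: dominated_mx => // i j.
have SC : classC 1 X (partial j (partial i H)).
  exact: classCW (classC_partial j (classC_partial i HC)).
apply: dominated_near (dominated_lipschitz oX Xx0 zx yx SC yz).
by apply: nearW => t; rewrite !mxE.
Qed.

Section Increments.
Variables (y z : K -> 'cV[K]_d).
Hypotheses (yx : y h @[h --> 0^'+] --> x0) (zx : z h @[h --> 0^'+] --> x0).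

Let x0x : (fun _ : K => x0) @ 0^'+ --> x0. Proof. exact: cvg_cst. Qed.

Lemma avf_bounded : dominated (0 : K)^'+ (fun=> 1) (fun h => avf H x0 (y h)).
Proof.
have H2 : classC 2 X H by do 2!apply: classCW.
have yx0 : dominated (0 : K)^'+ (fun=> 1) (fun h => y h - x0).
  apply: dominatedB; last exact: dominated_cst.
  exact: cvg_is_dominated yx.
have diff : dominated (0 : K)^'+ (fun=> 1) (fun h => avf H x0 (y h) - avf H x0 x0).
  by apply: (dominated_avf oX H2 Xx0 yx x0x _ yx0); apply: nearW => h; exact: ler01.
apply: dominated_near (dominatedD diff (dominated_cst _ (avf H x0 x0))).
by apply: nearW => h; rewrite subrK.
Qed.

Lemma hess_midpoint_bounded :
  dominated (0 : K)^'+ (fun=> 1) (fun h => hess H (midpoint x0 (y h))).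
Proof. exact: (dominated_hess Xx0 (midpoint_cvg x0x yx) HC). Qed.

End Increments.

Lemma increment_lipschitz (y z : K -> 'cV[K]_d) :
  y h @[h --> 0^'+] --> x0 -> z h @[h --> 0^'+] --> x0 ->
  dominated 0^'+ (fun h => `|y h - z h|)
    (fun h => corrected_increment h (y h) - corrected_increment h (z h)).
Proof.
move=> yx zx; pose e h := `|y h - z h|.
have e0 : \forall h \near 0^'+, 0 <= e h by apply: nearW => h; exact: normr_ge0.
have yz : dominated 0^'+ e (fun h => y h - z h).
  by exists 1; apply: nearW => h; rewrite mul1r.
have x0x : (fun _ : K => x0) @ 0^'+ --> x0 by exact: cvg_cst.
have H2 : classC 2 X H by do 2!apply: classCW.
have vv : dominated 0^'+ e (fun h => avf H x0 (y h) - avf H x0 (z h)).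
  exact: (dominated_avf oX H2 Xx0 yx zx e0 yz).
have mm : dominated 0^'+ e (fun h => midpoint x0 (y h) - midpoint x0 (z h)).
  apply: dominated_near (bounded_scale (dominated_cst _ (2^-1 : K)) yz).
  apply: nearW => h; rewrite /midpoint -scalerBr; congr (_ *: _).
  by rewrite opprD addrACA subrr add0r.
have SS : dominated 0^'+ e
    (fun h => hess H (midpoint x0 (y h)) - hess H (midpoint x0 (z h))).
  exact: (hess_lipschitz (midpoint_cvg x0x yx) (midpoint_cvg x0x zx) e0 mm).
have WW : dominated 0^'+ e
    (fun h => W (hess H (midpoint x0 (y h))) - W (hess H (midpoint x0 (z h)))).
  exact: (dominated_words (hess_midpoint_bounded yx) (hess_midpoint_bounded zx) SS).
have Wz : dominated 0^'+ (fun=> 1) (fun h => W (hess H (midpoint x0 (z h)))).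
  exact: (dominated_words_bounded (hess_midpoint_bounded zx)).
have k1 : dominated (0 : K)^'+ (fun=> 1) (fun h => h ^+ 2 / 12).
  apply: dominated_le dominated_step_coef; near=> h.
  have h0 : 0 < h by [].
  by rewrite sqr_ge0 exprn_ile1 ?(ltW h0)//; near: h; exact: nbhs_right_le.
have B1 : dominated (0 : K)^'+ (fun=> 1) (fun=> B) by exact: dominated_cst.
apply: dominated_near (dominatedB (bounded_mulmx B1 vv) (bounded_scale k1
  (dominatedD (mulmx_bounded WW (avf_bounded yx)) (bounded_mulmx Wz vv)))).
by apply: nearW => h; rewrite !corrected_incrementE mulmx_difference.
Unshelve. all: by end_near. Qed.

(** The defect of the averaged gradient involves the Hessian and the gradient at
    the middle of the solution, the correction involves the Hessian at the
    middle of the chord and the averaged gradient.  They differ by [O(h ^+ 2)],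
    and the correction carries a factor [h ^+ 2]. *)
Lemma increment_consistency (T : K) (c : K -> 'cV[K]_d) : 0 < T -> c 0 = x0 ->
  (forall t : K, 0 <= t < T -> X (c t)) -> {within `[0, T[, continuous c} ->
  (forall t : K, 0 < t < T -> is_derive t 1 c (B *m grad H (c t))) ->
  c h @[h --> 0^'+] --> x0 ->
  dominated 0^'+ (fun h => h ^+ 4)
    (fun h => corrected_increment h (c h) - h^-1 *: (c h - x0)).
Proof.
move=> T0 c0 cX cc cd' cx.
have cd t : 0 < t < T -> is_derive t 1 c (\col_i flow_field H B i (c t)).
  move=> tT; rewrite (_ : \col_i _ = B *m grad H (c t)); first exact: cd'.
  by apply/colP => i; rewrite mxE.
have defect := avf_defect_mx oX HC T0 c0 cX cc cd.
have slope := chord_slope oX HC T0 c0 cX cc cd.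
have midgap := midpoint_gap oX HC T0 c0 cX cc cd.
have x0x : (fun _ : K => x0) @ 0^'+ --> x0 by exact: cvg_cst.
have mx : midpoint x0 (c h) @[h --> 0^'+] --> x0 by exact: midpoint_cvg x0x cx.
have hx : c (h / 2) @[h --> 0^'+] --> x0.
  have := flow_mid_cvg T0 c0 cc; move=> ec A /ec eA.
  by apply: (@filterS _ (0^'+) _ _ _ _ eA) => h /(_ 0); rewrite lexx ler01; exact.
have B1 : dominated (0 : K)^'+ (fun=> 1) (fun=> B) by exact: dominated_cst.
have Sm := hess_midpoint_bounded cx.
have Sc : dominated (0 : K)^'+ (fun=> 1) (fun h => hess H (c (h / 2))).
  exact: (dominated_hess Xx0 hx HC).
have SS : dominated 0^'+ (fun h => h ^+ 2)
    (fun h => hess H (midpoint x0 (c h)) - hess H (c (h / 2))).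
  exact: (hess_lipschitz mx hx (near_step_pow 2) midgap).
have WW : dominated 0^'+ (fun h => h ^+ 2)
    (fun h => W (hess H (midpoint x0 (c h))) - W (hess H (c (h / 2)))).
  exact: (dominated_words Sm Sc SS).
pose S h := hess H (c (h / 2)); pose G h := grad H (c (h / 2)).
pose v h := avf H x0 (c h).
have v1 : dominated 0^'+ (fun=> 1) v by exact: avf_bounded.
have small2 h : 0 <= h <= 1 -> 0 <= h ^+ 4 <= h ^+ 2.
  by move=> /andP[h0 h1]; rewrite exprn_ge0//= ler_wiXn2l.
have P1 : dominated 0^'+ (fun=> 1) (fun h => B *m S h *m (B *m S h)).
  by do 3?[apply: bounded_mulmx => //].
(* The averaged gradient and the gradient at the middle of the step give the
   same field up to second order: both are close to the chord slope. *)
have Bv : dominated 0^'+ (fun h => h ^+ 2) (fun h => B *m v h - B *m G h).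
  have low : dominated 0^'+ (fun h => h ^+ 2) (fun h =>
      (h ^+ 2 / 12) *: (B *m S h *m (B *m S h *m (B *m G h)))).
    have G1 : dominated 0^'+ (fun=> 1) G.
      apply: dominated_mx => [|i k]; first by apply: nearW => h; exact: ler01.
      apply: dominated_near (dominated_classC Xx0 hx (classC_partial i HC)).
      by apply: nearW => h; rewrite mxE.
    have Q1 : dominated 0^'+ (fun=> 1) (fun h => B *m S h *m (B *m S h *m (B *m G h))).
      by do 4?[apply: bounded_mulmx => //].
    apply: dominated_bound_eq (dominatedZ dominated_step_coef Q1).
    by apply: nearW => h; rewrite mulr1.
  apply: dominated_near (dominatedD (dominatedD (dominated_le _ defect) low) slope).
    apply: nearW => h; rewrite -/(S h) -/(G h) -/(v h).
    by rewrite subrK addrA subrK.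
  near=> h; apply: small2; apply/andP; split=> //.
  by near: h; exact: nbhs_right_le.
have tail : dominated 0^'+ (fun h => h ^+ 4) (fun h => (h ^+ 2 / 12) *:
    ((W (hess H (midpoint x0 (c h))) - W (S h)) *m v h
     + B *m S h *m (B *m S h) *m (B *m v h - B *m G h))).
  have in2 : dominated 0^'+ (fun h => h ^+ 2) (fun h =>
      (W (hess H (midpoint x0 (c h))) - W (S h)) *m v h
     + B *m S h *m (B *m S h) *m (B *m v h - B *m G h)).
    by apply: dominatedD; [exact: mulmx_bounded|exact: bounded_mulmx].
  apply: dominated_bound_eq (dominatedZ dominated_step_coef in2).
  by apply: nearW => h; rewrite -exprD.
apply: dominated_near (dominatedB defect tail).
apply: nearW => h; rewrite corrected_incrementE -/(S h) -/(G h) -/(v h).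
exact: mulmx_defect.
Unshelve. all: by end_near. Qed.

End OrderFour.

(** * Local error of the method *)

Section Convergence.
Context {K : realType} {d : nat}.

(** The error of an implicit step also appears on the right; there it carries a
    factor [h * C1], which is at most one half for small [h]. *)
Lemma implicit_step_error (e r : K -> 'cV[K]_d) (n : nat) :
  (\forall h \near 0^'+, h^-1 *: e h = r h) ->
  (exists C1 C2 : K, \forall h \near 0^'+, `|r h| <= C1 * `|e h| + C2 * h ^+ n) ->
  e =O_ (0^'+) (fun h => h ^+ n.+1).
Proof.
move=> er [C1 [C2 rC]]; apply/eqO_exP.
exists (2 * `|C2| + 1); first by rewrite ltr_wpDl// mulr_ge0.
near=> h.
have h0 : 0 < h by [].
have hC1 : h * `|C1| <= 2^-1.
  have C1' : 0 < `|C1| + 1 by rewrite ltr_wpDl.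
  rewrite (@le_trans _ _ (h * (`|C1| + 1)))//.
    by rewrite ler_wpM2l ?(ltW h0)// lerDl.
  rewrite -ler_pdivlMr//.
  by near: h; apply: nbhs_right_le; rewrite divr_gt0.
have erh : h^-1 *: e h = r h by near: h.
have rCh : `|r h| <= C1 * `|e h| + C2 * h ^+ n by near: h.
have hn : 0 <= h ^+ n by rewrite exprn_ge0// ltW.
have eh : `|e h| <= h * (`|C1| * `|e h| + `|C2| * h ^+ n).
  rewrite -ler_pdivrMl// -[X in X * _]ger0_norm ?invr_ge0 ?(ltW h0)// -normrZ erh.
  by apply: le_trans rCh _; apply: lerD; apply: ler_wpM2r => //; exact: ler_norm.
have half : h * `|C1| * `|e h| <= 2^-1 * `|e h| by rewrite ler_wpM2r.
have hn1 : 0 <= h ^+ n.+1 by rewrite exprn_ge0// ltW.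
rewrite (ger0_norm hn1).
have : `|e h| <= 2 * `|C2| * h ^+ n.+1.
  rewrite exprS; move: eh half; rewrite mulrDr !mulrA [h * `|C2|]mulrC.
  move: (`|e h|) (h * `|C1| * _) (h ^+ n) => a b f; rewrite -!mulrA.
  by move: (`|C2| * (h * f)) => q; lra.
move=> /le_trans; apply; rewrite ler_wpM2r//.
by rewrite lerDl.
Unshelve. all: by end_near. Qed.

End Convergence.

Theorem theorem4 :
  exists k : nat,
  forall (K : realType) (d : nat) (J R : 'M[K]_d)
    (X : set 'cV[K]_d) (H : 'cV[K]_d -> K)
    (m : nat) (alpha : 'I_m -> K)
    (C D : 'I_m -> 'cV[K]_d -> 'cV[K]_d -> 'M[K]_d),
  skew_symmetric J ->
  sym_psd R ->
  open X ->
  classC k X H ->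
  (1 <= m)%N ->
  (forall j, 0 <= alpha j) ->
  (forall j, {within [set p | admissible X p.1 p.2],
     continuous (fun p : 'cV[K]_d * 'cV[K]_d => C j p.1 p.2)}) ->
  (forall j, {within [set p | admissible X p.1 p.2],
     continuous (fun p : 'cV[K]_d * 'cV[K]_d => D j p.1 p.2)}) ->
  \sum_(j < m) alpha j = 1 ->
  (forall x y, admissible X x y ->
     \sum_(j < m) alpha j *: ((C j x y)^T *m R + R *m C j x y) = 0) ->
  (forall x y, admissible X x y ->
     \sum_(j < m) alpha j *: ((C j x y)^T *m R *m C j x y
                              + (D j x y)^T *m R + R *m D j x y)
     = - (12^-1 *: (T1 H J R (midpoint x y) + T3 H R (midpoint x y)))) ->
  (forall x y, admissible X x y ->
     \sum_(j < m) alpha j *: ((C j x y)^T *m R *m D j x y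
                              + (D j x y)^T *m R *m C j x y) = 0) ->
  energy_consistent X H J R (Jbar H J R) (Rbar R alpha C D) /\
  of_order X H J R 4 (fun x y h => Jbar H J R x y h - Rbar R alpha C D x y h).
Proof.
(* Expanding the coordinates of the solution up to order four uses three
   derivatives of the field, that is, four derivatives of [H]. *)
exists 4 => K d J R X H m alpha C D skJ psdR oX HC _ alpha0 CC DC alpha1 o1 o2 o3.
have H1 : classC 1 X H by do 3!apply: classCW.
have H2 : classC 2 X H by do 2!apply: classCW.
have mid x y : admissible X x y -> X (midpoint x y).
  move=> xy; have -> : midpoint x y = chord x y 2^-1.
    by rewrite /midpoint /chord; apply/colP => i; rewrite !mxE; field.
  by apply: xy; rewrite invr_ge0 invf_le1// ler0n ler1n.
have skJbar x y h : admissible X x y -> skew_symmetric (Jbar H J R x y h).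
  by move=> xy; exact: (Jbar_skew oX skJ psdR.1 _ H2 (mid _ _ xy)).
have psdRbar x y h : sym_psd (Rbar R alpha C D x y h).
  by apply: sym_psd_sum => // j; exact: sym_psd_congruence.
split; first split.
- by move=> x y h; exact: skJbar.
- by move=> x y h _; exact: psdRbar.
- move=> x Xx.
  apply: (modified_cvg alpha1 o1 o2 o3 oX Xx _ _ DC H2).
  + exact: cvg_cst.
  + exact: cvg_fst.
  + exact: cvg_snd.
- move=> x y h step; have [xy h0 _] := step.
  rewrite (energy_balance oX H1 (skJbar x y h xy) step) oppr_le0.
  have [_ pos] := psdRbar x y h.
  by apply: mulr_ge0; [exact: ltW|exact: pos].
- move=> R0 x y h step; have [xy h0 _] := step.
  rewrite (energy_balance oX H1 (skJbar x y h xy) step).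
  rewrite (_ : Rbar R alpha C D x y h = 0) ?mulmx0 ?mul0mx ?mxE ?mulr0 ?oppr0//.
  by rewrite /Rbar big1// => j _; rewrite R0 mulmx0 mul0mx scaler0.
move=> x0 T x x1 T0 [xx0 xX xc xd] step x1c.
have Xx0 : X x0 by rewrite -xx0; apply: xX; rewrite lexx.
have xcvg : x h @[h --> 0^'+] --> x0.
  have := flow_end_cvg T0 xx0 xc; move=> ec A /ec eA.
  by apply: (@filterS _ (0^'+) _ _ _ _ eA) => h /(_ 0); rewrite lexx ler01; exact.
pose B := J - R.
pose r0 h := corrected_increment H B x0 h (x h) - corrected_increment H B x0 h (x1 h).
pose r1 h := corrected_increment H B x0 h (x h) - h^-1 *: (x h - x0).
pose r2 h := h ^+ 4 *: (remainder R alpha D x0 (x1 h) *m avf H x0 (x1 h)).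
have [C0 r0C] : dominated 0^'+ (fun h => `|x h - x1 h|) r0.
  exact: (increment_lipschitz B oX HC Xx0 xcvg x1c).
have r1C : dominated 0^'+ (fun h => h ^+ 4) r1.
  exact: (increment_consistency oX HC Xx0 T0 xx0 xX xc xd xcvg).
have r2C : dominated 0^'+ (fun h => h ^+ 4) r2.
  have E1 : dominated 0^'+ (fun=> 1) (fun h => remainder R alpha D x0 (x1 h)).
    by apply: (dominated_remainder _ _ oX Xx0 _ x1c DC); exact: cvg_cst.
  have v1 := avf_bounded oX HC Xx0 x1c.
  apply: dominated_bound_eq (dominatedZ (dominated_refl (near_step_pow 4))
    (bounded_mulmx E1 v1)).
  by apply: nearW => h; rewrite mulr1.
have [C1 r12C] := dominatedB r2C r1C.
apply: (@implicit_step_error K d _ (fun h => r0 h + (r2 h - r1 h))).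
  apply: filterS step => h [adm h0 E].
  rewrite /r0 /r1 /r2; rewrite (modified_expansion alpha1 o1 o2 o3)// in E.
  rewrite mulmxBl -scalemxAl -/(corrected_increment H B x0 h (x1 h)) in E.
  have -> : x h - x1 h = (x h - x0) - (x1 h - x0) by rewrite opprB addrA subrK.
  rewrite scalerBr E.
  move: (_ *: (remainder _ _ _ _ _ *m _)) (h^-1 *: _) => a b.
  move: (corrected_increment _ _ _ _ (x h)) (corrected_increment _ _ _ _ _) => e f.
  by apply/colP => i; rewrite !mxE; ring.
exists C0, C1; apply: filterS2 r0C r12C => h le0 le1.
by rewrite (le_trans (ler_normD _ _))// lerD.
Qed.
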